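(* Let $k \ge 3$ and $t \ge 1$ be integers, let $s_0 = \left\lceil \frac{3t}{t+1} \right\rceil$, and let $G$ be a connected $\frac{t}{t(k-1)+1}$-tough graph of order $n$. Define $$N_1(s_0,k) = \max\left\{ (s_0+1)k + s_0 + 3 + \frac{2s_0+5}{k-2} + \frac{4}{(k-2)^2},\ \ s_0^2 + \frac{2k^2-5k+6}{2(k-2)}\,s_0 + \frac{k^2+3k-8}{2(k-2)} \right\}$$ and $$N_2(s_0,k) = \max\left\{ (s_0+1)k + s_0 + 3 + \frac{2s_0+5}{k-2} + \frac{4}{(k-2)^2},\ \ \frac{1}{2}(s_0+1)^2 k + \frac{3s_0+5}{2} + \frac{2s_0+3}{k-2} \right\}.$$ Then each of the following holds. (i) If $n \ge N_1(s_0,k)$ and $\rho(G) \ge \rho\big(K_{s_0} \vee (K_{n-s_0(k-1)-2} \cup (s_0(k-2)+2)K_1)\big)$, then $G$ contains a spanning $k$-tree. (ii) If $n \ge N_2(s_0,k)$ and $q(G) \ge q\big(K_{s_0} \vee (K_{n-s_0(k-1)-2} \cup (s_0(k-2)+2)K_1)\big)$, then $G$ contains a spanning $k$-tree.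
   Context: All graphs are finite, undirected and simple. The order of a graph $G$ is $n=|V(G)|$. For a graph $G$, $c(G)$ denotes its number of connected components. For a real number $\tau$, a graph $G$ is $\tau$-tough if $|S| \ge \tau\cdot c(G-S)$ for every vertex subset $S \subseteq V(G)$ with $c(G-S) \ge 2$ (in particular every complete graph is $\tau$-tough for every $\tau$). For an integer $k \ge 2$, a $k$-tree is a tree $T$ with $d_T(v) \le k$ for every vertex $v \in V(T)$ (maximum degree at most $k$). A spanning $k$-tree of a connected graph $G$ is a $k$-tree $T$ that is a subgraph of $G$ with $V(T)=V(G)$. $\rho(G)$ (the spectral radius) is the largest eigenvalue of the adjacency matrix $A(G)$, and $q(G)$ (the signless Laplacian spectral radius) is the largest eigenvalue of $Q(G)=D(G)+A(G)$, where $D(G)$ is the diagonal matrix of vertex degrees. $K_m$ is the complete graph on $m$ vertices; $G_1 \cup G_2$ is the disjoint union of $G_1$ and $G_2$; $mK_1$ is the disjoint union of $m$ isolated vertices; the join $G_1 \vee G_2$ is obtained from the disjoint union $G_1 \cup G_2$ by adding all edges between $V(G_1)$ and $V(G_2)$. $\lceil c \rceil$ is the smallest integer greater than or equal to $c$. *)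

(* Defs.v *)
From mathcomp Require Import all_boot all_order all_algebra.
From mathcomp Require Import classical_sets reals.

Set Implicit Arguments.
Unset Strict Implicit.
Unset Printing Implicit Defensive.

Import Order.TTheory GRing.Theory Num.Theory.
Local Open Scope ring_scope.

Record sgraph := SGraph {
  vertex :> finType;
  adj : rel vertex;
  adj_sym : symmetric adj;
  adj_irr : irreflexive adj }.

Section Constructions.
Local Open Scope nat_scope.

Definition complete_rel (n : nat) : rel 'I_n := [rel i j | i != j].
Fact complete_sym n : symmetric (@complete_rel n).
Proof. by move=> i j; rewrite /complete_rel /= eq_sym. Qed.
Fact complete_irr n : irreflexive (@complete_rel n).
Proof. by move=> i; rewrite /complete_rel /= eqxx. Qed.
Definition complete n := SGraph (@complete_sym n) (@complete_irr n).

Definition edgeless_rel (n : nat) : rel 'I_n := [rel i j | false].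
Fact edgeless_sym n : symmetric (@edgeless_rel n). Proof. by []. Qed.
Fact edgeless_irr n : irreflexive (@edgeless_rel n). Proof. by []. Qed.
Definition edgeless n := SGraph (@edgeless_sym n) (@edgeless_irr n).

(* Common shape of the disjoint union and the join: [b] tells whether
   vertices lying in different summands are adjacent. *)
Definition sum_rel (b : bool) (G H : sgraph) : rel (G + H)%type :=
  fun u v => match u, v with
             | inl x, inl y => adj x y
             | inr x, inr y => adj x y
             | _, _ => b
             end.
Fact sum_sym b G H : symmetric (@sum_rel b G H).
Proof. by case=> x [y|y] //=; rewrite adj_sym. Qed.
Fact sum_irr b G H : irreflexive (@sum_rel b G H).
Proof. by case=> x /=; rewrite adj_irr. Qed.
Definition disjoint_union G H := SGraph (@sum_sym false G H) (@sum_irr false G H).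
Definition join G H := SGraph (@sum_sym true G H) (@sum_irr true G H).

Definition induced_rel (G : sgraph) (A : {set G}) : rel {x : G | x \in A} :=
  [rel x y | adj (val x) (val y)].
Fact induced_sym G A : symmetric (@induced_rel G A).
Proof. by move=> x y; rewrite /induced_rel /= adj_sym. Qed.
Fact induced_irr G A : irreflexive (@induced_rel G A).
Proof. by move=> x; rewrite /induced_rel /= adj_irr. Qed.
Definition induced G A := SGraph (@induced_sym G A) (@induced_irr G A).

Definition delete (G : sgraph) (S : {set G}) := induced (~: S).

End Constructions.

Section Invariants.
Local Open Scope nat_scope.

Definition num_components (G : sgraph) : nat := n_comp (@adj G) predT.

Definition connected (G : sgraph) : Prop := num_components G = 1.

Definition degree (G : sgraph) (v : G) : nat := #|[set w | adj v w]|.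

(* In a simple graph the one-vertex sequences are not cycles, but an edge
   traversed back and forth is a [ucycle] of size 2. *)
Definition acyclic (G : sgraph) : Prop :=
  forall p : seq G, ucycle (@adj G) p -> size p <= 2.

Definition is_tree (G : sgraph) : Prop := connected G /\ acyclic G.

Definition is_ktree (k : nat) (G : sgraph) : Prop :=
  is_tree G /\ forall v : G, degree v <= k.

Definition has_spanning_ktree (k : nat) (G : sgraph) : Prop :=
  exists (f : rel G) (fsym : symmetric f) (firr : irreflexive f),
    subrel f (@adj G) /\ is_ktree k (SGraph fsym firr).

End Invariants.

Definition tough (R : realType) (tau : R) (G : sgraph) : Prop :=
  forall S : {set G}, (2 <= num_components (delete S))%N ->
    tau * (num_components (delete S))%:R <= #|S|%:R.

Definition adjacency (R : realType) (G : sgraph) : 'M[R]_#|G| :=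
  \matrix_(i, j) (adj (enum_val i) (enum_val j))%:R.

Definition signless_laplacian (R : realType) (G : sgraph) : 'M[R]_#|G| :=
  diag_mx (\row_i (degree (enum_val i))%:R) + adjacency R G.

(* A square matrix has finitely many eigenvalues, and a real symmetric one of
   positive size has at least one, so for the matrices above this supremum is
   a maximum. *)
Definition largest_eigenvalue (R : realType) (n : nat) (A : 'M[R]_n) : R :=
  sup [set a : R | eigenvalue A a]%classic.

Definition rho (R : realType) (G : sgraph) : R :=
  largest_eigenvalue (adjacency R G).

Definition q (R : realType) (G : sgraph) : R :=
  largest_eigenvalue (signless_laplacian R G).

(* The subtractions are truncated; the graph has order [n] as soon as
   [2 <= k] and [s * (k - 1) + 2 <= n]. *)
Definition extremal (n k s : nat) : sgraph :=
  join (complete s)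
    (disjoint_union (complete (n - s * (k - 1) - 2))
                    (edgeless (s * (k - 2) + 2))).

Definition N1 (R : realType) (s k : R) : R :=
  Num.max
    ((s + 1) * k + s + 3 + (2 * s + 5) / (k - 2) + 4 / (k - 2) ^+ 2)
    (s ^+ 2 + (2 * k ^+ 2 - 5 * k + 6) / (2 * (k - 2)) * s
      + (k ^+ 2 + 3 * k - 8) / (2 * (k - 2))).

Definition N2 (R : realType) (s k : R) : R :=
  Num.max
    ((s + 1) * k + s + 3 + (2 * s + 5) / (k - 2) + 4 / (k - 2) ^+ 2)
    (1 / 2 * (s + 1) ^+ 2 * k + (3 * s + 5) / 2 + (2 * s + 3) / (k - 2)).

(* Main.v *)
Require Import Defs.
From mathcomp Require Import all_boot all_order all_algebra.
From mathcomp Require Import boolp classical_sets reals.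
From mathcomp Require Import zify ring lra.

(** Suppose that [G] has no spanning k-tree.

    A theorem of Win ([ktree_or_scattered]) then provides a vertex set [S] such
    that [G - S] has at least [(k - 2)|S| + 3] components.  The proof follows
    Ellingham and Zha.  Take a spanning tree [F] minimising the total excess
    of the degrees over [k], and grow a set [S] from the vertices whose degree
    cannot be lowered by rearranging [F] inside the components left by the
    previous set.  When the growth stops, no edge of [G] joins two components
    of [F - S]: such an edge could be exchanged for an edge of [F] at a vertex
    of [S] ([closed_off_grow]).  Every vertex of [S] has degree at least [k] in
    [F] and one has more, so [F - S] has the announced number of components.
    Toughness then forces [|S| >= s0], and [s0] is 2 or 3.

    Both spectral radii are largest eigenvalues of [B = c D + A], with [c = 0]
    for the adjacency matrix and [c = 1] for the signless Laplacian.  If a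
    positive vector [x] satisfies [B x <= lam x], strictly somewhere, and [G] is
    connected, then all eigenvalues of [B] are below [lam]
    ([eigenvalue_lt_of_supersolution]).  The vector used is 1 on [S] and
    [(s / (1 + c)) / (mu - m)] on a component of order [m] of [G - S], where
    [lam = (1 + c)(mu - 1) + c s].  This is the vector for which the rows outside
    [S] would be equalities if [G] were the join of a clique on [S] with disjoint
    cliques.  The rows in [S] contain the sum of [m / (mu - m)] over the
    components, which by convexity is largest when all components but one are
    single vertices.  So everything reduces to one scalar inequality
    ([comparison]), and equality forces [G] to be the join of a clique on [S]
    with isolated vertices and one clique.

    Let [s = |S|].  If [s > s0], the scalar inequality holds strictly for
    [lam = (1 + c)(n - s0 (k - 2) - 3)], which is at most the eigenvalue of the
    extremal graph because that graph contains a clique of order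
    [n - s0 (k - 2) - 2]; this is where the lower bounds on [n] are used
    ([extra_vertices_ineq0], [extra_vertices_ineq1]).  If [s = s0], take for
    [lam] the eigenvalue of the extremal graph itself: either [G] has a smaller
    spectral radius, or it is the extremal graph.  The extremal graph does have
    a spanning k-tree, because [s0 >= 2]: take a path through its two cliques
    starting and ending in the joining clique, and hang the isolated vertices
    on the latter ([clique_with_pendants]). *)

Set Implicit Arguments.
Unset Strict Implicit.
Unset Printing Implicit Defensive.

Import Order.TTheory GRing.Theory Num.Theory.

(** * Trees given by a parent function *)

Section GraphTheory.
Local Open Scope nat_scope.

Lemma connectedP (G : sgraph) :
  connected G <-> (exists r : G, forall v : G, connect (@adj G) v r).
Proof.
have csym := sym_connect_sym (@adj_sym G); split.
- move=> G1; have /card1P[r rE] : #|predI (roots (@adj G)) predT| == 1 by apply/eqP.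
  exists r => v; have := rE (fingraph.root (@adj G) v).
  rewrite !inE roots_root // => /esym /eqP <-; exact: connect_root.
- move=> [r rP]; rewrite /connected /num_components -(n_comp_connect csym r).
  by apply: eq_n_comp_r => v; rewrite !inE csym rP.
Qed.

Definition parent_rel (V : finType) (r : V) (par : V -> V) : rel V :=
  [rel u v | (u != r) && (par u == v) || (v != r) && (par v == u)].

Definition deg (V : finType) (f : rel V) (v : V) := #|[set w | f v w]|.

Definition children (V : finType) (r : V) (par : V -> V) (v : V) :=
  [set u | (u != r) && (par u == v)].

Lemma deg_parent_rel (V : finType) (r : V) (par : V -> V) (v : V) :
  deg (parent_rel r par) v <= (v != r) + #|children r par v|.
Proof.
have -> : (v != r) + #|children r par v|
        = #|[set u in pred1 (par v) | v != r]| + #|children r par v|.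
  congr (_ + _); case: (v != r).
    rewrite (_ : [set _ in _ | _] = [set par v]) ?cards1 //.
    by apply/setP => u; rewrite !inE andbT.
  by apply/esym/eq_card0 => u; rewrite !inE andbF.
apply: leq_trans (leq_card_setU _ _); apply: subset_leq_card.
apply/fintype.subsetP => u; rewrite !inE => /orP[/andP[-> /eqP->]|->]; last by rewrite orbT.
by rewrite eqxx.
Qed.

Section ParentTree.
Variables (V : finType) (r : V) (par : V -> V) (h : V -> nat).
Hypothesis h_par : forall v, v != r -> h (par v) < h v.

Lemma parent_rel_sym : symmetric (parent_rel r par).
Proof. by move=> u v; rewrite /parent_rel /= orbC. Qed.

Lemma parent_rel_irr : irreflexive (parent_rel r par).
Proof.
move=> u; rewrite /parent_rel /= orbb; apply/negP => /andP[ur /eqP pu].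
by have := h_par ur; rewrite pu ltnn.
Qed.

Lemma parent_connect v : connect (parent_rel r par) v r.
Proof.
have [m] := ubnP (h v); elim: m v => // m IH v hv.
case: (eqVneq v r) => [->|vr]; first exact: connect0.
apply: (@connect_trans _ _ (par v)).
  by apply: connect1; rewrite /parent_rel /= vr eqxx.
by apply: IH; apply: leq_trans (h_par vr) _.
Qed.

Lemma parent_rel_down u v : parent_rel r par u v -> h v <= h u ->
  u != r /\ v = par u.
Proof.
case/orP=> /andP[ur /eqP <-] // huv.
by have := leq_ltn_trans huv (h_par ur); rewrite ltnn.
Qed.

(** The vertex of a cycle furthest from the root has its parent as its only
    neighbour on the cycle, so its successor and predecessor coincide. *)
Lemma parent_acyclic (p : seq V) :
  cycle (parent_rel r par) p -> uniq p -> size p <= 2.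
Proof.
move=> cp up; rewrite leqNgt; apply/negP => sp.
have [x0 x0p] : exists x, x \in p by case: p sp {cp up} => // x p; exists x; rewrite inE eqxx.
case: (@arg_maxnP V x0 (mem p) h x0p) => v vp vmax.
have pv : prev p v \in p by rewrite mem_prev.
have nv : next p v \in p by rewrite mem_next.
have e1 := next_cycle cp vp; have e2 := prev_cycle cp vp.
have [vr n_v] := parent_rel_down e1 (vmax _ nv).
have [_ p_v] : v != r /\ prev p v = par v.
  by apply: parent_rel_down (vmax _ pv); rewrite parent_rel_sym.
have nE : next p v = prev p v :> V by rewrite n_v p_v.
case/rot_to: vp => i q qE.
move: nE; rewrite -(next_rot i up) -(prev_rot i up) qE.
have : uniq (v :: q) by rewrite -qE rot_uniq.
have : 2 < size (v :: q) by rewrite -qE size_rot.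
move=> sq /andP[vq uq].
rewrite next_nth prev_nth inE eqxx /= => nE.
have sq0 : 0 < size q by case: (q) sq.
have {}nE : nth v q 0 = nth v q (size q).-1.
  move: nE; rewrite (memNindex vq) /= eqxx => ->.
  by rewrite -[in LHS](prednK sq0).
move/eqP: nE; rewrite nth_uniq ?prednK //.
by case: (q) sq => [|a [|b l]].
Qed.

Lemma parent_is_tree : is_tree (SGraph parent_rel_sym parent_rel_irr).
Proof.
split; first by apply/connectedP; exists r; exact: parent_connect.
by move=> p /andP[cp up]; exact: parent_acyclic.
Qed.
End ParentTree.

Lemma parent_spanning_ktree (G : sgraph) (k : nat) (r : G) (par : G -> G)
    (h : G -> nat) :
  (forall v, v != r -> adj v (par v) /\ h (par v) < h v) ->
  (forall v, deg (parent_rel r par) v <= k) ->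
  has_spanning_ktree k G.
Proof.
move=> parP degP.
have h_par v : v != r -> h (par v) < h v by move=> /parP[].
exists (parent_rel r par), (@parent_rel_sym _ r par), (parent_rel_irr h_par).
split; last by split; [exact: parent_is_tree | exact: degP].
move=> u v /orP[/andP[ur /eqP<-]|/andP[vr /eqP<-]]; first by case: (parP u ur).
by rewrite adj_sym; case: (parP v vr).
Qed.

(** A breadth-first parent: one step closer to the root. *)
Lemma parent_exists (V : finType) (f : rel V) (r : V) :
  (forall v, connect f v r) ->
  exists (par : V -> V) (h : V -> nat),
    forall v, v != r -> f v (par v) /\ h (par v) < h v.
Proof.
move=> fr.
have dP v : exists n, [exists p : n.-tuple V, path f v p && (last v p == r)].
  have /connectP[p fp rE] := fr v; exists (size p).
  by apply/existsP; exists (in_tuple p); rewrite /= fp rE eqxx.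
pose d v := ex_minn (dP v).
have d_le v p : path f v p -> last v p = r -> d v <= size p.
  move=> fp lp; rewrite /d; case: ex_minnP => m _; apply.
  by apply/existsP; exists (in_tuple p); rewrite /= fp lp eqxx.
pose par v := if [pick w | f v w && (d w < d v)] is Some w then w else v.
exists par, d => v vr; rewrite /par; case: pickP => [w /andP[]//|no]; exfalso.
have /existsP[[p /= /eqP sp]] : [exists p : (d v).-tuple V, path f v p && (last v p == r)].
  by rewrite /d; case: ex_minnP.
case: p sp => [_ /=|w p sp]; first by rewrite (negbTE vr).
move=> /andP[/andP[vw wp] /eqP lp].
by have := no w; rewrite vw -sp ltnS d_le.
Qed.

(** * Exchanging edges outside a vertex set *)

Definition avoid (V : finType) (f : rel V) (S : {set V}) : rel V :=
  [rel u v | [&& f u v, u \notin S & v \notin S]].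

Lemma avoid_sym (V : finType) (f : rel V) (S : {set V}) :
  symmetric f -> symmetric (avoid f S).
Proof. by move=> fs u v; rewrite /avoid /= fs [(u \notin S) && _]andbC. Qed.

(** Transfer of connectedness along walks that cannot leave [A]. *)
Lemma connect_in (V : finType) (e e' : rel V) (A : pred V) (u v : V) :
  (forall a b, A a -> e a b -> A b /\ connect e' a b) ->
  A u -> connect e u v -> connect e' u v.
Proof.
move=> eA Au /connectP[p]; elim: p u Au => [|b p IH] u Au /=; first by move=> _ ->.
move=> /andP[ub bp] lp; have [Ab ub'] := eA _ _ Au ub.
exact: connect_trans ub' (IH _ Ab bp lp).
Qed.

Section Exchange.
Variables (G : sgraph) (F : rel G) (k : nat).
Hypotheses (F_sym : symmetric F) (F_conn : forall u v, connect F u v).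
Hypothesis (F_adj : subrel F (@adj G)).

(** The excess degrees of [F] are tolerated where they already occur, so that
    no rearrangement allowed below increases the total excess over [k]. *)
Definition degree_cap (v : G) := maxn k (deg F v).

(** The rearrangements of [F] that keep the edges at [S] and only replace, inside
    each component of [F - S], the edges by other edges connecting it.  They are
    not required to be trees: connectedness is what survives an exchange, and a
    tree is extracted at the end. *)
Record swap (S : {set G}) (f : rel G) : Prop := Swap {
  swap_sym : symmetric f;
  swap_adj : subrel f (@adj G);
  swap_fix : forall u w, u \in S -> f u w = F u w;
  swap_conn : connect (avoid f S) =2 connect (avoid F S);
  swap_deg : forall v, deg f v <= degree_cap v }.

(** The degree of [v] cannot be brought below the cap. *)
Definition saturated (S : {set G}) (v : G) : Prop :=
  forall f, swap S f -> degree_cap v <= deg f v.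

Definition grow (S : {set G}) : {set G} := S :|: [set v | `[< saturated S v >]].

(** No edge of the graph that could still be added joins two components of
    [F - S]. *)
Definition closed_off (S : {set G}) : Prop :=
  forall x y, x \notin grow S -> y \notin grow S -> adj x y ->
    connect (avoid F S) x y.

Lemma swap_refl (S : {set G}) : swap S F.
Proof. by split=> // v; rewrite /degree_cap leq_maxr. Qed.

Lemma not_grow (S : {set G}) v : v \notin grow S ->
  v \notin S /\ exists2 f, swap S f & deg f v < degree_cap v.
Proof.
rewrite !inE negb_or => /andP[-> /asboolPn nst]; split=> //.
have /existsNP[f /not_implyP[sf /negP]] := nst.
by rewrite -ltnNge => df; exists f.
Qed.

Lemma avoid_connect_notin (f : rel G) (S : {set G}) x y :
  x \notin S -> connect (avoid f S) x y -> y \notin S.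
Proof.
move=> xS /connectP[p]; elim: p x xS => [|z p IH] x xS /=; first by move=> _ ->.
by move=> /andP[/and3P[_ _ zS] zp]; exact: IH.
Qed.

(** Rearrangements in different components are independent: use [f1] in the
    component of [x] and [f2] in all the others. *)
Lemma swap_merge (S : {set G}) x f1 f2 : x \notin S -> swap S f1 -> swap S f2 ->
  exists f, [/\ swap S f,
    forall v, connect (avoid F S) x v -> deg f v = deg f1 v &
    forall v, v \notin S -> ~~ connect (avoid F S) x v -> deg f v = deg f2 v].
Proof.
move=> xS s1 s2; pose Q v := connect (avoid F S) x v.
have QS v : Q v -> v \notin S by exact: avoid_connect_notin.
have Qs f : swap S f -> forall v w, Q v -> avoid f S v w -> Q w.
  move=> sf v w Qv fvw; apply: connect_trans Qv _.
  by rewrite -(swap_conn sf); exact: connect1.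
have nQs f : swap S f -> forall v w, ~~ Q v -> avoid f S v w -> ~~ Q w.
  move=> sf v w Qv fvw; apply: contra Qv => Qw; apply: (Qs f sf) Qw _.
  by rewrite (avoid_sym S (swap_sym sf)).
pose f v w := if Q v || Q w then f1 v w else f2 v w.
have fE1 v w : Q v -> f v w = f1 v w by rewrite /f => ->.
have fE2 v w : v \notin S -> ~~ Q v -> f v w = f2 v w.
  move=> vS nQv; rewrite /f (negbTE nQv) /=; case: ifP => // Qw.
  have wS := QS _ Qw.
  have no f' : swap S f' -> f' v w = false.
    move=> sf; apply/negP => vw; have : avoid f' S v w by apply/and3P.
    by move/(nQs _ sf _ _ nQv); rewrite Qw.
  by rewrite !no.
have d1 v : Q v -> deg f v = deg f1 v.
  by move=> Qv; apply: eq_card => w; rewrite !inE fE1.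
have d2 v : v \notin S -> ~~ Q v -> deg f v = deg f2 v.
  by move=> vS Qv; apply: eq_card => w; rewrite !inE fE2.
have ffix u w : u \in S -> f u w = F u w.
  by move=> uS; rewrite /f; case: ifP; rewrite (swap_fix s1, swap_fix s2).
exists f; split=> //; split.
- by move=> v w; rewrite /f orbC (swap_sym s1) (swap_sym s2).
- by move=> v w; rewrite /f; case: ifP => _; [exact: (swap_adj s1) | exact: (swap_adj s2)].
- exact: ffix.
- move=> u v; apply/idP/idP.
    apply: connect_sub => {u v} u v /and3P[uv uS vS]; move: uv; rewrite /f.
    case: ifP => _ uv; [rewrite -(swap_conn s1)|rewrite -(swap_conn s2)];
    by apply: connect1; apply/and3P.
  case: (boolP (Q u)) => Qu.
    rewrite -(swap_conn s1); apply: (connect_in (A := Q)) => // a b Qa ab.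
    split; first exact: (Qs f1) ab.
    by apply: connect1; move: ab; rewrite /avoid /= fE1.
  rewrite -(swap_conn s2); apply: (connect_in (A := fun v => ~~ Q v)) => // a b Qa ab.
  split; first exact: (nQs f2) ab.
  by case/and3P: (ab) => ab' aS bS; apply: connect1; rewrite /avoid /= fE2 ?ab' ?aS.
- move=> v; case: (boolP (v \in S)) => vS.
    rewrite (_ : deg f v = deg F v) ?leq_maxr //.
    by apply: eq_card => w; rewrite !inE ffix.
  by case: (boolP (Q v)) => Qv; [rewrite d1 // (swap_deg s1) | rewrite d2 // (swap_deg s2)].
Qed.

(** Suppose that an edge [xy] joins two components of [F - S'], where [S'] is
    [grow S] and neither end is saturated for [S'].  Free one degree at [x] and
    one at [y] simultaneously by [swap_merge].  As [x] and [y] lie in one component for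
    [S], there is a path between them avoiding [S], and it meets [S'] in a first
    vertex [u].  Adding [xy] and deleting the path edge that enters [u] gives a
    rearrangement for [S] in which the degree of [u] has dropped, although [u]
    is saturated for [S]. *)
Lemma closed_off_grow S : closed_off S -> closed_off (grow S).
Proof.
move=> clS x y xN yN xy; set S' := grow S.
have sSS' : S \subset S' by apply/fintype.subsetP => z zS; rewrite inE zS.
have [xS' [fx sx dx]] := not_grow xN; have [yS' [fy sy dy]] := not_grow yN.
apply: contrapT => /negP nxy.
have [f [sf df1 df2]] := swap_merge xS' sx sy.
have {df1 dx} dx : deg f x < degree_cap x by rewrite df1.
have {df2 dy} dy : deg f y < degree_cap y by rewrite df2.
have S'S z : z \notin S' -> z \notin S by apply: contra; apply: (fintype.subsetP sSS').
have monoS' g : subrel (avoid g S') (avoid g S).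
  by move=> a b /and3P[ab aS bS]; rewrite /avoid /= ab !S'S.
(* Deleting fewer vertices only glues components along edges at S', which
   are the same for all rearrangements. *)
have transfer g1 g2 : (forall u w, u \in S' -> g1 u w = g2 u w) ->
    symmetric g1 -> symmetric g2 ->
    subrel (connect (avoid g1 S')) (connect (avoid g2 S')) ->
    subrel (connect (avoid g1 S)) (connect (avoid g2 S)).
  move=> g12 s1 s2 sub; apply: connect_sub => a b abS; case/and3P: (abS) => ab aS bS.
  case: (boolP (a \in S')) => [aS'|aS'].
    by apply: connect1; rewrite /avoid /= -g12 // ab aS.
  case: (boolP (b \in S')) => [bS'|bS'].
    by apply: connect1; rewrite /avoid /= s2 -g12 // s1 ab aS.
  apply: (connect_sub (e := avoid g2 S')) => [u v uv|].
    by apply: connect1; apply: monoS'.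
  by apply: sub; apply: connect1; rewrite /avoid /= ab aS' bS'.
have fF : connect (avoid f S) =2 connect (avoid F S).
  move=> u v; apply/idP/idP; apply: transfer;
    rewrite ?(swap_sym sf) //; try exact: (swap_sym sf).
  - by move=> a b; exact: (swap_fix sf).
  - by move=> a b; rewrite (swap_conn sf).
  - by move=> a b aS; rewrite (swap_fix sf).
  - by move=> a b; rewrite (swap_conn sf).
have : connect (avoid f S) x y by rewrite fF; apply: clS.
case/connectP => p0 /shortenP[p pp up _ {p0}] yE.
(* A path avoiding S' would put x and y in one component of F - S'. *)
have hp : has (mem S') p.
  apply/negPn/negP => /hasPn hp; move: nxy => /negP; apply.
  rewrite -(swap_conn sf); apply/connectP; exists p => //.
  elim: p (x) xS' pp hp {up yE} => //= z p IH a aS' /andP[az zp] hp.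
  have zS' : z \notin S' by apply: hp; rewrite inE eqxx.
  rewrite IH // ?andbT; last by move=> b bp; apply: hp; rewrite inE bp orbT.
  by case/and3P: az => az _ _; rewrite /avoid /= az aS'.
case: (split_find hp) pp up yE => u p1 p2 uS0 np1.
have {uS0} uS' : u \in S' by [].
rewrite cat_path rcons_path last_cat last_rcons -cats1 -catA cat_cons /=.
set w := last x p1 => /andP[/andP[pp1 wu] pp2] /andP[xp up] yE.
case/and3P: (wu) => fwu wS uS.
have p1S z : z \in x :: p1 -> z \notin S'.
  rewrite inE => /predU1P[->//|zp1]; apply: (hasPn np1) zp1.
have wS' : w \notin S' by apply: p1S; exact: mem_last.
have wp2 : w \notin u :: p2.
  have : uniq ((x :: p1) ++ (u :: p2)) by rewrite cat_cons /= xp up.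
  rewrite cat_uniq => /and3P[_ /hasPn h _]; apply/negP => /h/negP; apply.
  exact: mem_last.
have uNx : u != x by apply: contraNneq xS' => <-.
have uNy : u != y by apply: contraNneq yS' => <-.
(* Exchange the path edge wu for xy. *)
pose cut a b := (a == w) && (b == u) || (a == u) && (b == w).
pose new a b := (a == x) && (b == y) || (a == y) && (b == x).
pose g a b := f a b && ~~ cut a b || new a b.
have cut_sym a b : cut a b = cut b a.
  by rewrite /cut orbC andbC; congr (_ || _); rewrite andbC.
have new_sym a b : new a b = new b a.
  by rewrite /new orbC andbC; congr (_ || _); rewrite andbC.
have gsym : symmetric g by move=> a b; rewrite /g (swap_sym sf) cut_sym new_sym.
have nin (S0 : {set G}) a b : a \in S0 -> b \notin S0 -> (a == b) = false.
  by move=> aS; apply: contraNF => /eqP<-.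
have gfix a b : a \in S -> g a b = F a b.
  move=> aS; rewrite /g /cut /new (nin _ _ _ aS wS) (nin _ _ _ aS uS).
  rewrite (nin _ _ _ aS (S'S _ xS')) (nin _ _ _ aS (S'S _ yS')) /= orbF andbT.
  by rewrite (swap_fix sf) ?(fintype.subsetP sSS').
have xyg : connect (avoid g S) x y.
  by apply: connect1; rewrite /avoid /= /g /new !eqxx orbT !S'S.
have uncut z : (z == u) || (z == w) -> forall a q, z \notin a :: q ->
    path (avoid f S) a q -> connect (avoid (g : rel G) S) a (last a q).
  move=> zuw a q zq fq; apply/connectP; exists q => //.
  apply: (sub_in_path (P := predC1 z)) fq => [b c bz cz /and3P[bc bS cS]|]; last first.
    by apply/allP => b bq; apply: contraNneq zq => <-.
  rewrite /avoid /= bS cS /g bc /cut !andbT /=; apply/orP; left.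
  move: bz cz; rewrite !inE; case/orP: zuw => /eqP-> bz cz.
    by rewrite (negbTE cz) (negbTE bz) andbF.
  by rewrite (negbTE cz) (negbTE bz) andbF.
have xwg : connect (avoid g S) x w.
  apply: (uncut u); rewrite ?eqxx //.
  by apply/negP => /p1S; rewrite uS'.
have uyg : connect (avoid g S) u y.
  by rewrite yE; apply: (uncut w); rewrite ?eqxx ?orbT.
have gc_sym := sym_connect_sym (avoid_sym S gsym).
(* The deleted edge is bypassed: w back to x, across xy, then back to u. *)
have wug : connect (avoid g S) w u.
  rewrite gc_sym; apply: connect_trans uyg _.
  by rewrite gc_sym in xyg; exact: connect_trans xyg xwg.
have sg : swap S g.
  split=> //.
  - move=> a b /orP[/andP[/(swap_adj sf)//]|/orP[]/andP[/eqP-> /eqP->]//].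
    by rewrite adj_sym.
  - move=> a b; rewrite -fF; apply/idP/idP; apply: connect_sub => {a b} a b /and3P[ab aS bS].
      case/orP: ab => [/andP[ab _]|]; first by apply: connect1; rewrite /avoid /= ab aS.
      have xyf : connect (avoid f S) x y by rewrite fF; apply: clS.
      case/orP=> /andP[/eqP-> /eqP->] //.
      by rewrite (sym_connect_sym (avoid_sym S (swap_sym sf))).
    case: (boolP (cut a b)) => [/orP[]/andP[/eqP-> /eqP->]|ncut] //.
      by rewrite gc_sym.
    by apply: connect1; rewrite /avoid /= /g ab ncut aS.
  (* The new edge costs one degree at x and one at y, and both had room for it. *)
  - have deg_new v z : (forall b, new v b = (b == z)) -> deg f v < degree_cap v ->
      deg g v <= degree_cap v.
      move=> newE lt; apply: leq_trans lt; rewrite /deg.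
      apply: leq_trans (_ : #|z |: [set w0 | f v w0]| <= _); last first.
        by rewrite cardsU1; case: (_ \notin _).
      apply: subset_leq_card; apply/fintype.subsetP => b; rewrite !inE /g newE orbC.
      by case/orP=> [->//|/andP[-> _]]; rewrite orbT.
    have xNy : x != y by apply: contraNneq nxy => ->; exact: connect0.
    move=> v; case: (eqVneq v x) => [->|vx].
      by apply: (deg_new x y) dx => b; rewrite /new eqxx (negbTE xNy) orbF.
    case: (eqVneq v y) => [->|vy].
      by apply: (deg_new y x) dy => b; rewrite /new eqxx eq_sym (negbTE xNy).
    apply: leq_trans (swap_deg sf v); apply: subset_leq_card.
    apply/fintype.subsetP => b; rewrite !inE /g /new (negbTE vx) (negbTE vy) orbF.
    by case/andP.
have stu : saturated S u.
  by move: uS'; rewrite !inE (negbTE uS) /= => /asboolP.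
have := stu _ sg; rewrite leqNgt => /negP; apply.
apply: leq_trans (swap_deg sf u); apply: proper_card; apply/properP; split.
  apply/fintype.subsetP => b; rewrite !inE /g /new (negbTE uNx) (negbTE uNy) orbF.
  by case/andP.
exists w; rewrite !inE; first by rewrite (swap_sym sf).
by rewrite /g /new /cut (negbTE uNx) (negbTE uNy) orbF !eqxx orbT andbF.
Qed.

(** Start from the empty set, for which being closed off is the connectedness
    of [F], and grow until the set is stable. *)
Lemma closed_off_exists (z : G) : saturated finset.set0 z ->
  exists S : {set G}, [/\ z \in S, forall v, v \in S -> degree_cap v <= deg F v
    & forall x y, x \notin S -> y \notin S -> adj x y -> connect (avoid F S) x y].
Proof.
move=> z0.
have inv n : let S := iter n grow finset.set0 in
  [/\ z \in grow S, (forall v, v \in S -> degree_cap v <= deg F v),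
      closed_off S & n <= #|S| \/ grow S = S].
  elim: n => [|n [zS Sb cS growS]] /=.
    split; [| by move=> v; rewrite inE | | by left].
      by rewrite inE; apply/orP; right; rewrite inE; apply/asboolP.
    move=> x y _ _ _; rewrite (_ : connect _ x y = connect F x y) //.
    by apply: eq_connect => a b; rewrite /avoid /= !inE !andbT.
  move: zS Sb cS growS; set S := iter n _ _ => zS Sb cS growS.
  split; [by rewrite inE zS | | exact: closed_off_grow |].
    move=> v; rewrite !inE => /orP[/Sb//|/asboolP vst]; apply: vst.
    exact: swap_refl.
  case: (eqVneq (grow S) S) => [gS|gS]; first by right; rewrite !gS.
  left; case: growS => [nS|/eqP]; last by rewrite (negbTE gS).
  apply: leq_ltn_trans nS _; apply: proper_card.
  by rewrite finset.properEneq eq_sym gS finset.subsetUl.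
have [zS Sb cS [big|gS]] := inv #|G|.+1.
  by have := leq_trans big (max_card _); rewrite ltnn.
by exists (iter #|G|.+1 grow finset.set0); split=> //; move: zS cS; rewrite /closed_off gS.
Qed.
End Exchange.

(** * Spanning k-trees and scattering sets *)

Section Tops.
Variables (V : finType) (r : V) (par : V -> V) (h : V -> nat) (S : {set V}).
Hypothesis h_par : forall v, v != r -> h (par v) < h v.

(** The vertices closest to the root in the components of the rooted tree
    minus [S]. *)
Definition tops : {set V} := [set v | (v \notin S) && ((v == r) || (par v \in S))].

(** Along an edge of the tree that avoids [S], a vertex that climbs to the top
    [x] through vertices that are not tops leads to another such vertex. *)
Lemma tops_separated x y : x \in tops -> y \in tops ->
  connect (avoid (parent_rel r par) S) x y -> x = y.
Proof.
move=> xt yt cxy.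
pose reach v := exists2 m, iter m par v = x & forall i, i < m -> iter i par v \notin tops.
have reach_path p v : path (avoid (parent_rel r par) S) v p -> reach v -> reach (last v p).
  elim: p v => [|w p IH] v //= /andP[/and3P[vw vS wS] wp] [m mE mtop]; apply: IH wp _.
  case/orP: vw => /andP[vr /eqP vw].
    case: m mE mtop => [/= vx _|m mE mtop].
      by move: xt; rewrite -vx !inE (negbTE vr) vw (negbTE wS) andbF.
    exists m; first by rewrite -vw -iterSr.
    by move=> i im; rewrite -vw -iterSr; exact: mtop.
  exists m.+1; first by rewrite iterSr vw.
  case=> [_ /=|i im]; first by rewrite !inE (negbTE vr) vw (negbTE vS) andbF.
  by rewrite iterSr vw; exact: mtop.
case/connectP: cxy yt => p xp -> yt.
case: (reach_path _ _ xp (ex_intro2 _ _ 0 erefl _)) => // -[//|m] _ /(_ 0 isT) /=.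
by rewrite yt.
Qed.

(** A vertex of [S] with degree [d] has at least [d - 1] children ([d] if it is
    the root), and every child outside [S] is a top.  At most [|S| - 1] of
    these children lie in [S], since the vertex of [S] closest to the root is
    not one of them; and the root is one more top if it is outside [S]. *)
Lemma card_tops k : S != finset.set0 -> (forall v, v \in S -> k <= deg (parent_rel r par) v) ->
  (exists2 v, v \in S & k < deg (parent_rel r par) v) -> 2 <= k ->
  (k - 2) * #|S| + 3 <= #|tops|.
Proof.
move=> S0 degS [z zS zk] k2.
pose W := [set v | (v != r) && (par v \in S)].
have cW : #|W| = \sum_(u in S) #|children r par u|.
  rewrite -sum1_card (partition_big par (mem S)) /=; last by move=> v; rewrite inE => /andP[].
  apply: eq_bigr => u uS; rewrite -sum1_card; apply: eq_bigl => v.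
  by rewrite !inE; case: (par v =P u) => [->|_]; rewrite ?uS ?andbT ?andbF.
have rS : \sum_(u in S) (u != r) + (r \in S) = #|S|.
  case: (boolP (r \in S)) => rS.
    rewrite (cardsD1 r) rS addnC; congr (_ + _); rewrite (bigD1 r) //= eqxx add0n.
    rewrite -sum1_card; apply: eq_big => [u|u /andP[_ ->]//].
    by rewrite !inE andbC.
  rewrite addn0 -sum1_card; apply: eq_bigr => u uS.
  by rewrite (_ : u != r) //; apply: contraNneq rS => <-.
have sumk : k * #|S| + 1 <= \sum_(u in S) (u != r) + #|W|.
  rewrite cW -big_split /= (bigD1 z) //= (cardsD1 z) zS mulnDr muln1.
  have h1 := leq_trans zk (deg_parent_rel r par z).
  have : k * #|S :\ z| <= \sum_(i in S | i != z) ((i != r) + #|children r par i|).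
    rewrite mulnC -sum_nat_const.
    rewrite [leqLHS](eq_bigl (fun i => (i \in S) && (i != z))); last first.
      by move=> i; rewrite !inE andbC.
    apply: leq_sum => u /andP[uS _]; apply: leq_trans (degS u uS) _.
    exact: deg_parent_rel.
  lia.
have WS : #|W :&: S| + 1 <= #|S|.
  have [v vS vmin] : exists2 v, v \in S & forall u, u \in S -> h v <= h u.
    by case/set0Pn: S0 => x xS; case: (@arg_minnP V x (mem S) h xS) => v vS vmin; exists v.
  rewrite (cardsD1 v S) vS addnC leq_add2l; apply: subset_leq_card.
  apply/fintype.subsetP => u; rewrite !inE => /andP[/andP[ur pS] uS]; rewrite uS andbT.
  by apply: contraTneq (h_par ur) => uv; rewrite -leqNgt uv; apply: vmin; rewrite -uv.
have tE : #|tops| = (r \notin S) + #|W :\: S|.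
  rewrite (cardsD1 r); congr (_ + _); first by rewrite inE eqxx andbT.
  apply: eq_card => v; rewrite !inE.
  by case: (eqVneq v r) => //=; rewrite andbF.
have := cardsID S W; nia.
Qed.
End Tops.

Definition excess (V : finType) (k : nat) (f : rel V) := \sum_v (deg f v - k).

(** [X] witnesses that [G - S] has at least [|X|] components. *)
Definition scattered (G : sgraph) (S X : {set G}) : Prop :=
  (forall x, x \in X -> x \notin S) /\
  (forall x y, x \in X -> y \in X -> connect (avoid (@adj G) S) x y -> x = y).

(** Win's theorem.  In a spanning tree of minimum excess, either no degree is
    above [k], or the set grown from a vertex [z] of larger degree is as wanted. *)
Lemma ktree_or_scattered (G : sgraph) (k : nat) : 2 <= k -> connected G ->
  has_spanning_ktree k G \/
  exists S X : {set G}, [/\ S != finset.set0, scattered S X & (k - 2) * #|S| + 3 <= #|X|].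
Proof.
move=> k2 /connectedP[r rP].
pose good (f : rel G) := [/\ symmetric f, subrel f (@adj G) & forall u v, connect f u v].
have [f [fs fadj fc] fmin] : exists2 f, good f & forall g, good g -> excess k f <= excess k g.
  have good_adj : good (@adj G).
    split=> //; first exact: adj_sym.
    move=> u v; apply: connect_trans (rP u) _.
    by rewrite (sym_connect_sym (@adj_sym G)).
  have [m] := ubnP (excess k (@adj G)).
  elim: m (@adj G : rel G) good_adj => // m IH f fgood fm.
  case: (pselect (exists2 g, good g & excess k g < excess k f)) => [[g gg gf]|no].
    by apply: IH gg _; apply: leq_trans gf _.
  by exists f => // g gg; rewrite leqNgt; apply/negP => gf; apply: no; exists g.
(* Passing to a spanning tree of f does not increase any degree. *)
have [par [h parP]] := parent_exists (fun v => fc v r).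
have h_par v : v != r -> h (par v) < h v by case/parP.
pose F := parent_rel r par.
have Fs : symmetric F := @parent_rel_sym _ r par.
have Ff : subrel F f.
  move=> u v /orP[]/andP[ur /eqP<-]; first by case: (parP _ ur).
  by rewrite fs; case: (parP _ ur).
have Fadj : subrel F (@adj G) by move=> u v /Ff/fadj.
have Fc u v : connect F u v.
  apply: connect_trans (parent_connect h_par u) _.
  by rewrite (sym_connect_sym Fs); exact: (parent_connect h_par).
have Fmin g : good g -> excess k F <= excess k g.
  move=> /fmin; apply: leq_trans; apply: leq_sum => v _; apply: leq_sub2r.
  by apply: subset_leq_card; apply/fintype.subsetP => w; rewrite !inE; exact: Ff.
case: (pselect (exists z, k < deg F z)) => [[z zk]|no]; last first.
  left; apply: (@parent_spanning_ktree G k r par h) => v.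
    by move=> /parP[/fadj ? ?].
  by rewrite leqNgt; apply/negP => kv; apply: no; exists v.
right.
(* A rearrangement lowering the degree of z would have a smaller excess than
   the minimum. *)
have z_stuck : saturated F k finset.set0 z.
  move=> g sg; rewrite leqNgt; apply/negP => gz.
  have gg : good g.
    split; [exact: swap_sym sg | exact: swap_adj sg |].
    have av0 (e : rel G) u v : connect (avoid e finset.set0) u v = connect e u v.
      by apply: eq_connect => a b; rewrite /avoid /= !inE !andbT.
    by move=> u v; rewrite -av0 (swap_conn sg) av0.
  have := Fmin _ gg; rewrite leqNgt => /negP; apply.
  rewrite /excess (bigD1 z) //= [ltnRHS](bigD1 z) //= -addSn; apply: leq_add.
    by move: gz zk; rewrite /degree_cap; lia.
  apply: leq_sum => v _; have := swap_deg sg v; rewrite /degree_cap; lia.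
have [S [zS Sdeg Scl]] := closed_off_exists Fs Fc Fadj z_stuck.
have S0 : S != finset.set0 by apply/set0Pn; exists z.
exists S, (tops r par S); split=> //; last first.
  apply: (card_tops h_par S0) => //; last by exists z.
  by move=> v /Sdeg; apply: leq_trans; rewrite /degree_cap leq_maxl.
split=> [x|x y xt yt cxy]; first by rewrite inE => /andP[].
apply: (tops_separated xt yt).
apply: connect_sub cxy => a b /and3P[ab aS bS]; exact: Scl.
Qed.

(** Write each [v] of [S] in a list [c v] times and give the elements of [I]
    successive places in it. *)
Lemma bounded_assignment (V : finType) (S I : {set V}) (c : V -> nat) :
  #|I| <= \sum_(v in S) c v ->
  exists phi : V -> V, (forall u, u \in I -> phi u \in S) /\
    forall v, v \in S -> #|[set u in I | phi u == v]| <= c v.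
Proof.
move=> cI; pose slots := flatten [seq nseq (c v) v | v <- enum S].
have size_slots : size slots = \sum_(v in S) c v.
  rewrite size_flatten /shape -map_comp sumnE big_map big_enum.
  by apply: eq_bigr => v _; rewrite /= size_nseq.
have count_slots v : v \in S -> count_mem v slots = c v.
  move=> vS; rewrite count_flatten -map_comp sumnE big_map big_enum (bigD1 v) //=.
  rewrite count_nseq /= eqxx mul1n big1 ?addn0 // => u /andP[_ uv].
  by rewrite count_nseq /= (negbTE uv).
pose phi u := nth u slots (index u (enum I)).
have lt_slots u : u \in I -> index u (enum I) < size slots.
  by move=> uI; rewrite size_slots (leq_trans _ cI) // cardE index_mem mem_enum.
exists phi; split=> [u uI|v vS].
  have /flattenP[l /mapP[v vS ->]] := mem_nth u (lt_slots u uI).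
  by rewrite /phi mem_nseq => /andP[_ /eqP->]; rewrite mem_enum in vS.
rewrite -(count_slots v vS).
have -> : #|[set u in I | phi u == v]| = count_mem v (map phi (enum I)).
  rewrite count_map -size_filter cardE /enum_mem -filter_predI; congr size.
  by apply: eq_filter => u; rewrite /= !inE andbC.
have -> : map phi (enum I) = take #|I| slots.
  apply: (@eq_from_nth _ v) => [|i].
    by rewrite size_map size_take_min -cardE size_slots (minn_idPl cI).
  rewrite size_map => iI; rewrite nth_take ?cardE //.
  rewrite (nth_map v) // /phi index_uniq ?enum_uniq //; apply: set_nth_default.
  by rewrite size_slots (leq_trans _ cI) // cardE.
by rewrite -[in leqRHS](cat_take_drop #|I| slots) count_cat leq_addr.
Qed.

(** Run a Hamiltonian path through the clique [C] between two vertices [a] and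
    [b] of [S], and hang the other vertices of the graph on [S].  A vertex of
    [S] has room for [k - 2] pendant vertices, and each of [a] and [b] for one
    more. *)
Lemma clique_with_pendants (G : sgraph) (k : nat) (S C : {set G}) :
  2 <= k -> 2 <= #|S| -> S \subset C ->
  (forall u v, u \in C -> v \in C -> u != v -> adj u v) ->
  (forall u v, u \in S -> u != v -> adj u v) ->
  #|~: C| <= #|S| * (k - 2) + 2 -> has_spanning_ktree k G.
Proof.
move=> k2 /card_gt1P[a [b [aS bS ab]]] SC cliqueC univS Cc.
have aC := fintype.subsetP SC _ aS; have bC := fintype.subsetP SC _ bS.
pose c v := (k - 2) + ((v == a) + (v == b)).
have sum_c : \sum_(v in S) c v = #|S| * (k - 2) + 2.
  have one z : z \in S -> \sum_(v in S) (v == z) = 1.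
    move=> zS; rewrite (bigD1 z) //= eqxx big1 ?addn0 // => v /andP[_ vz].
    by rewrite (negbTE vz).
  by rewrite big_split sum_nat_const /= big_split /= !one.
have [phi [phiS phi_c]] : exists phi : G -> G, (forall u, u \in ~: C -> phi u \in S) /\
    forall v, v \in S -> #|[set u in ~: C | phi u == v]| <= c v.
  by apply: bounded_assignment; rewrite sum_c.
pose mid := enum (C :\ a :\ b).
pose L := a :: rcons mid b.
have memL u : (u \in L) = (u \in C).
  rewrite inE mem_rcons inE mem_enum !inE.
  case: (eqVneq u a) => [->|_] /=; first by rewrite aC.
  by case: (eqVneq u b) => [->|_] /=; rewrite ?bC.
have uniqL : uniq L.
  by rewrite /= rcons_uniq mem_rcons inE !mem_enum !inE !eqxx (negbTE ab) /= enum_uniq.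
pose par u := if u \in C then nth a L (index u L).-1 else phi u.
pose h u := if u \in C then index u L else size L.
have idx0 u : u != a -> 0 < index u L by move=> ua; rewrite /= eq_sym (negbTE ua).
have parC u : u \in C -> par u \in C.
  move=> uC; rewrite /par uC -memL mem_nth //.
  by apply: leq_ltn_trans (leq_pred _) _; rewrite index_mem memL.
have index_par u : u \in C -> index (par u) L = (index u L).-1.
  move=> uC; rewrite /par uC index_uniq //.
  by apply: leq_ltn_trans (leq_pred _) _; rewrite index_mem memL.
have parP u : u != a -> adj u (par u) /\ h (par u) < h u.
  move=> ua; case: (boolP (u \in C)) => uC; last first.
    rewrite /par /h (negbTE uC); have uS := phiS u; rewrite finset.in_setC in uS.
    have {}uS := uS uC; have pC := fintype.subsetP SC _ uS; rewrite pC index_mem memL pC.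
    by rewrite adj_sym univS //; apply: contraNneq uC => <-.
  have lt : index (par u) L < index u L by rewrite index_par // prednK ?idx0.
  rewrite /h parC // uC lt; split=> //; apply: cliqueC => //; first exact: parC.
  by apply: contraTneq lt => <-; rewrite ltnn.
apply: (parent_spanning_ktree parP) => v.
apply: leq_trans (deg_parent_rel a par v) _.
pose pathc := [set u in C | (u != a) && (par u == v)].
have path_le : #|pathc| <= (v != b).
  case: (eqVneq v b) => [vb|vb] /=.
    rewrite leqn0 cards_eq0; apply/eqP/setP => u; rewrite !inE; apply/negP.
    case/and3P=> uC ua /eqP pu; have := index_par u uC; rewrite pu vb.
    have := idx0 u ua; have : index u L < size L by rewrite index_mem memL.
    have -> : index b L = (size L).-1.
      rewrite /= (negbTE ab) size_rcons -cats1 index_cat mem_enum !inE eqxx /=.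
      by rewrite eqxx addn0.
    lia.
  apply/card_le1_eqP => u u'; rewrite !inE => /and3P[uC ua /eqP pu] /and3P[u'C u'a /eqP pu'].
  have := index_par u uC; rewrite pu -pu' index_par // => e.
  have {}e : index u L = index u' L by have := idx0 u ua; have := idx0 u' u'a; lia.
  by have := congr1 (nth a L) e; rewrite !nth_index ?memL.
have sub : #|children a par v| <= #|pathc| + #|[set u in ~: C | phi u == v]|.
  apply: leq_trans (leq_card_setU _ _); apply: subset_leq_card.
  apply/fintype.subsetP => u; rewrite !inE => /andP[ua]; rewrite ua /par.
  by case: (boolP (u \in C)) => uC /= ->.
case: (boolP (v \in S)) => vS.
  have := phi_c v vS; rewrite /c; move: path_le sub.
  by case: (v == a); case: (v == b) => /=; lia.
have fib0 : #|[set u in ~: C | phi u == v]| = 0.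
  apply/eqP; rewrite cards_eq0; apply/eqP/setP => u; rewrite !inE.
  apply/negP => /andP[uC /eqP e]; move: vS; rewrite -e phiS //.
  by rewrite finset.in_setC.
by move: path_le sub; rewrite fib0; case: (v != a); case: (v != b) => /=; lia.
Qed.

End GraphTheory.

(** * Eigenvalues and positive test_vector vectors *)

Section Spectrum.
Local Open Scope ring_scope.

Lemma finite_ub (R : realDomainType) (b : R) (P : R -> Prop) (rs : seq R) :
  (forall x, P x -> x \in rs /\ x < b) -> exists2 m, m < b & forall x, P x -> x <= m.
Proof.
elim: rs P => [|y rs IH] P Prs.
  by exists (b - 1); [lra | move=> x /Prs[]].
have [m mb mP] : exists2 m, m < b & forall x, P x /\ x != y -> x <= m.
  by apply: IH => x [/Prs[]]; rewrite inE => /predU1P[->|//]; rewrite eqxx.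
exists (if y < b then Num.max m y else m) => [|x Px].
  by case: ifP => // yb; rewrite gt_max mb.
have [_ xb] := Prs _ Px; case: (eqVneq x y) => [<-|xy]; first by rewrite xb le_max lexx orbT.
by case: ifP => _; rewrite ?le_max mP.
Qed.

Lemma finite_roots (F : fieldType) (p : {poly F}) : p != 0 ->
  exists rs : seq F, forall x, root p x -> x \in rs.
Proof.
have [m] := ubnP (size p); elim: m p => // m IH p sp p0.
case: (pselect (exists x, root p x)) => [[x px]|no]; last first.
  by exists [::] => x px; case: no; exists x.
have /factor_theorem[q pE] := px.
have q0 : q != 0 by apply: contraNneq p0 => q0; rewrite pE q0 mul0r.
have [|rs rsP] := IH q _ q0.
  by move: sp; rewrite pE size_Mmonic ?monicXsubC // size_XsubC addn2.
exists (x :: rs) => y; rewrite pE rootM root_XsubC inE orbC.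
by case/orP=> [->//|/rsP->]; rewrite orbT.
Qed.

Lemma finite_eigenvalues (F : fieldType) (n : nat) (A : 'M[F]_n) :
  exists rs : seq F, forall a, eigenvalue A a -> a \in rs.
Proof.
have [|rs rsP] := @finite_roots F (char_poly A).
  by apply: monic_neq0; exact: char_poly_monic.
by exists rs => a; rewrite eigenvalue_root_char => /rsP.
Qed.

Variable R : realType.

(** A strict bound on every eigenvalue passes to the supremum because there are
    finitely many of them.  The supremum of an empty set is 0, whence the
    positivity of [b]. *)
Lemma largest_eigenvalue_lt (n : nat) (A : 'M[R]_n) (b : R) :
  0 < b -> (forall a, eigenvalue A a -> a < b) -> largest_eigenvalue A < b.
Proof.
move=> b0 Ab; have [rs rsP] := finite_eigenvalues A.
have [m mb mP] := @finite_ub R b (fun a => eigenvalue A a) rs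
  (fun a Aa => conj (rsP a Aa) (Ab a Aa)).
rewrite /largest_eigenvalue; case: (pselect ([set a | eigenvalue A a] !=set0)%classic) => [ne|].
  by apply: le_lt_trans mb; apply: ge_sup.
by move/set0P/negP; rewrite negbK => /eqP->; rewrite sup0.
Qed.

Lemma eigenvalue_le_largest (n : nat) (A : 'M[R]_n) (a : R) :
  eigenvalue A a -> a <= largest_eigenvalue A.
Proof.
move=> Aa; have [rs rsP] := finite_eigenvalues A.
apply: ub_le_sup => //; exists (\sum_(x <- rs) `|x|) => x /rsP xrs.
apply: le_trans (ler_norm x) _; rewrite (big_rem x) //= lerDl sumr_ge0 //.
Qed.

(** [c = 0] gives the adjacency matrix, [c = 1] the signless Laplacian. *)
Definition deg_adj (c : R) (G : sgraph) : 'M[R]_#|G| :=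
  c *: diag_mx (\row_i (degree (enum_val i))%:R) + adjacency R G.

Lemma rho_deg_adj (G : sgraph) : rho R G = largest_eigenvalue (deg_adj 0 G).
Proof. by rewrite /deg_adj scale0r add0r. Qed.

Lemma q_deg_adj (G : sgraph) : q R G = largest_eigenvalue (deg_adj 1 G).
Proof. by rewrite /deg_adj scale1r. Qed.

(** The action of [deg_adj c G] on functions on the vertices, which frees the
    eigenvector computations from the numbering of the vertices. *)
Definition act (c : R) (G : sgraph) (y : G -> R) (w : G) : R :=
  c * (degree w)%:R * y w + \sum_(u | adj w u) y u.

Lemma deg_adj_eigenvalueP (c : R) (G : sgraph) (a : R) :
  eigenvalue (deg_adj c G) a <->
  exists2 y : G -> R, exists w, y w != 0 & forall w, act c y w = a * y w.
Proof.
have actE (v : 'rV[R]_#|G|) (j : 'I_#|G|) :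
    (v *m deg_adj c G) 0 j = act c (fun w => v 0 (enum_rank w)) (enum_val j).
  rewrite /deg_adj mulmxDr mxE -scalemxAr mul_mx_diag !mxE /act enum_valK; congr (_ + _).
    by rewrite mulrA mulrAC.
  rewrite [RHS]big_mkcond /= (reindex (fun i : 'I_#|G| => enum_val i)) /=; last first.
    exact: onW_bij (enum_val_bij _).
  apply: eq_bigr => i _; rewrite enum_valK mxE adj_sym.
  by case: (adj _ _); rewrite ?mulr1 ?mulr0.
split.
  case/eigenvalueP => v vA v0; exists (fun w => v 0 (enum_rank w)).
    have /rV0Pn[i vi] := v0; exists (enum_val i); by rewrite enum_valK.
  by move=> w; have := actE v (enum_rank w); rewrite vA enum_rankK mxE.
case=> y [w yw] yE; apply/eigenvalueP; pose v : 'rV[R]_#|G| := \row_i y (enum_val i).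
have vE u : v 0 (enum_rank u) = y u by rewrite mxE enum_rankK.
exists v.
  apply/rowP => j; rewrite actE !mxE -yE /act enum_valK mxE; congr (_ + _).
  by apply: eq_bigr => u _; rewrite vE.
by apply/rV0Pn; exists (enum_rank w); rewrite vE.
Qed.

(** Let [z] be the absolute value of an eigenvector for [a]; then
    [B z >= a z].  Pairing with [x] and using the symmetry of [B],
    [(lam - a) <x, z>] is the sum of the nonnegative quantities
    [z (lam x - B x)] and [x (B z - a z)].  If [a >= lam], all of them vanish:
    [z] is zero at [w0], and the zeros of [z] propagate along edges. *)
Lemma eigenvalue_lt_of_supersolution (c : R) (G : sgraph) (x : G -> R) (lam a : R) (w0 : G) :
  0 <= c -> connected G -> (forall w, 0 < x w) ->
  (forall w, act c x w <= lam * x w) -> act c x w0 < lam * x w0 ->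
  eigenvalue (deg_adj c G) a -> a < lam.
Proof.
move=> c0 /connectedP[r rP] x0 xle xlt /deg_adj_eigenvalueP[y [w yw] yE].
rewrite ltNge; apply/negP => lam_a.
pose z u := `|y u|.
have z0 u : 0 <= z u by exact: normr_ge0.
have zle u : a * z u <= act c z u.
  apply: le_trans (_ : `|a * y u| <= _).
    by rewrite normrM ler_wpM2r ?ler_norm.
  rewrite -yE /act; apply: le_trans (ler_normD _ _) _.
  by rewrite normrM ger0_norm ?mulr_ge0 // lerD2l ler_norm_sum.
have self_adj : \sum_u x u * act c z u = \sum_u z u * act c x u.
  rewrite /act; under eq_bigr => u _ do rewrite mulrDr mulr_sumr.
  under [RHS]eq_bigr => u _ do rewrite mulrDr mulr_sumr.
  rewrite !big_split /=; congr (_ + _); first by apply: eq_bigr => u _; ring.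
  rewrite (exchange_big_dep predT) //=; apply: eq_bigr => v _.
  by apply: eq_big => [u|u _]; [rewrite adj_sym | rewrite mulrC].
pose gx u := z u * (lam * x u - act c x u).
pose gz u := x u * (act c z u - a * z u).
have gx0 u : 0 <= gx u by rewrite mulr_ge0 // subr_ge0.
have gz0 u : 0 <= gz u by rewrite mulr_ge0 ?subr_ge0 // ltW.
have sum0 : \sum_u (gx u + gz u) <= 0.
  have -> : \sum_u (gx u + gz u) = (lam - a) * \sum_u x u * z u.
    rewrite /gx /gz mulr_sumr.
    transitivity (\sum_u (x u * act c z u - z u * act c x u)
      + \sum_u (lam - a) * (x u * z u)).
      by rewrite -big_split /=; apply: eq_bigr => u _; ring.
    by rewrite sumrB self_adj subrr add0r.
  rewrite mulr_le0_ge0 ?subr_le0 //; apply: sumr_ge0 => u _; by rewrite mulr_ge0 // ltW.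
have g0 u : gx u + gz u = 0.
  apply: (psumr_eq0P (P := predT) (F := fun u => gx u + gz u)) => //.
    by move=> v _; rewrite addr_ge0.
  by apply/eqP; rewrite eq_le sum0 sumr_ge0 // => v _; rewrite addr_ge0.
have z_w0 : z w0 = 0.
  have /eqP := g0 w0; rewrite paddr_eq0 // /gx mulf_eq0 subr_eq0 => /andP[/orP[/eqP//|/eqP e] _].
  by move: xlt; rewrite e ltxx.
have z_step u v : z u = 0 -> adj u v -> z v = 0.
  move=> zu uv; have /eqP := g0 u; rewrite paddr_eq0 // => /andP[_].
  rewrite /gz mulf_eq0 gt_eqF //= zu mulr0 subr0 /act zu mulr0 add0r => /eqP s0.
  exact: (psumr_eq0P _ s0).
have conn : connect (@adj G) w0 w.
  by apply: connect_trans (rP w0) _; rewrite (sym_connect_sym (@adj_sym G)).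
suff : z w = 0 by move/eqP; rewrite normr_eq0 (negbTE yw).
case/connectP: conn => p; elim: p (w0) z_w0 => [|v p IH] u zu /=; first by move=> _ ->.
by case/andP=> uv; apply: IH; exact: z_step uv.
Qed.

Lemma degreeE (G : sgraph) (w : G) : (degree w)%:R = \sum_(u | adj w u) 1 :> R.
Proof. by rewrite /degree -sum1_card natr_sum; apply: eq_bigl => u; rewrite inE. Qed.

Lemma sum_complete (m : nat) (i : 'I_m) (x : R) :
  \sum_(j | (i : complete m) != j) x = (m%:R - 1) * x.
Proof.
rewrite sumr_const (eq_card (B := predC1 i)); last by move=> j; rewrite !inE eq_sym.
rewrite cardC1 card_ord -[in RHS](prednK (leq_ltn_trans (leq0n i) (ltn_ord i))).
by rewrite -addn1 natrD addrK mulr_natl.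
Qed.

(** The extremal graph, with free block sizes. *)
Definition three_block (s m p : nat) :=
  join (complete s) (disjoint_union (complete m) (edgeless p)).

Definition block_fun (s m p : nat) (x y z : R) (w : three_block s m p) : R :=
  match w with inl _ => x | inr (inl _) => y | inr (inr _) => z end.

Lemma sum_blocks (s m p : nat) (x y z : R) (w : three_block s m p) :
  \sum_(u | adj w u) block_fun x y z u =
  block_fun ((s%:R - 1) * x + m%:R * y + p%:R * z)
            (s%:R * x + (m%:R - 1) * y) (s%:R * x) w.
Proof.
rewrite big_mkcond /= big_sumType /= big_sumType /=.
have cst n (t : R) : \sum_(i < n) t = n%:R * t.
  by rewrite sumr_const card_ord mulr_natl.
have zero n : \sum_(i < n) (0 : R) = 0 by rewrite big1.
by case: w => [i|[i|i]]; rewrite /= -?big_mkcond /= ?sum_complete ?cst ?zero ?mulr0; ring.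
Qed.

Lemma three_block_eigenvalue (s m p : nat) (c lam y z : R) : (0 < s)%N ->
  c * (s%:R - 1 + m%:R + p%:R) + (s%:R - 1) + m%:R * y + p%:R * z = lam ->
  c * (s%:R + m%:R - 1) * y + s%:R + (m%:R - 1) * y = lam * y ->
  c * s%:R * z + s%:R = lam * z ->
  eigenvalue (deg_adj c (three_block s m p)) lam.
Proof.
move=> s0 e1 e2 e3; apply/deg_adj_eigenvalueP.
exists (block_fun 1 y z) => [|w].
  by exists (inl (Ordinal s0)); rewrite /= oner_neq0.
rewrite /act degreeE sum_blocks.
rewrite (eq_bigr (block_fun 1 1 1)); last by case=> [i|[i|i]].
by rewrite sum_blocks; case: w => [i|[i|i]] /=; lra.
Qed.

End Spectrum.

(** * Comparing a graph that has a scattering set with the extremal graph *)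

Section Compare.
Local Open Scope ring_scope.
Variables (R : realType) (G : sgraph) (S X : {set G}) (p : nat).
Hypotheses (X_scat : scattered S X) (X_card : (p < #|X|)%N).

Definition component (v : G) : {set G} := [set w | connect (avoid (@adj G) S) v w].

Let compC : connect_sym (avoid (@adj G) S).
Proof. exact: sym_connect_sym (avoid_sym S (@adj_sym G)). Qed.

Lemma mem_component v : v \in component v. Proof. by rewrite inE. Qed.

Lemma component_eq v w : w \in component v -> component w = component v.
Proof.
rewrite inE => vw; apply/setP => u; rewrite !inE.
by rewrite (same_connect compC vw).
Qed.

Lemma component_notin v w : v \notin S -> w \in component v -> w \notin S.
Proof. by rewrite inE; exact: avoid_connect_notin. Qed.

Lemma scattered_component_le1 v : (#|[set x in X | v \in component x]| <= 1)%N.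
Proof.
apply/card_le1_eqP => x y; rewrite !inE => /andP[xX xv] /andP[yX yv].
by case: X_scat => _; apply=> //; apply: connect_trans yv _; rewrite compC.
Qed.

Lemma component_card v : v \notin S -> (#|component v| + p <= #|~: S|)%N.
Proof.
move=> vS; have sub : component v :|: X \subset ~: S.
  apply/fintype.subsetP => w; rewrite finset.in_setU finset.in_setC.
  case/orP=> [/(component_notin vS)//|wX].
  by case: X_scat => XS _; exact: XS.
have XI : (#|component v :&: X| <= 1)%N.
  apply: leq_trans (scattered_component_le1 v); apply: subset_leq_card.
  by apply/fintype.subsetP => x; rewrite !inE compC andbC.
have := subset_leq_card sub; have := cardsUI (component v) X; lia.
Qed.

Lemma component_card_gt0 v : (0 < #|component v|)%N.
Proof. by apply/card_gt0P; exists v; exact: mem_component. Qed.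

(** The vertices of a component of order [m] contribute [m] times [1 / m],
    that is 1. *)
Lemma sum_inv_component : #|X|%:R <= \sum_(v in ~: S) (#|component v|%:R)^-1 :> R.
Proof.
have -> : #|X|%:R = \sum_(x in X) \sum_(v in ~: S | v \in component x) (#|component v|%:R)^-1 :> R.
  rewrite -sum1_card natr_sum; apply: eq_bigr => x xX.
  rewrite (eq_bigl (mem (component x))); last first.
    move=> v /=; rewrite finset.in_setC andb_idl // => vx.
    by apply: component_notin vx; case: X_scat => XS _; exact: XS.
  rewrite (eq_bigr (fun=> (#|component x|%:R)^-1)); last by move=> v /component_eq->.
  rewrite sumr_const -[RHS]mulr_natr mulVf //.
  by rewrite pnatr_eq0 -lt0n component_card_gt0.
rewrite (exchange_big_dep (mem (~: S))) /=; last by move=> x v _ /andP[].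
apply: ler_sum => v vS.
rewrite (eq_bigl (fun x => x \in [set x in X | v \in component x])); last first.
  by move=> x; rewrite !inE; move: vS; rewrite finset.in_setC => ->.
rewrite sumr_const -[leLHS]mulr_natr ler_piMr ?invr_ge0 ?ler0n //.
by rewrite lern1 scattered_component_le1.
Qed.

(** The join of a clique on [S] with a disjoint union of cliques, one on each
    component of [G - S]. *)
Definition closure_adj : rel G :=
  [rel u v | (u != v) && [|| u \in S, v \in S | v \in component u]].

Lemma adj_closure u v : adj u v -> closure_adj u v.
Proof.
move=> uv; apply/andP; split; first by apply: contraTneq uv => ->; rewrite adj_irr.
case: (boolP (u \in S)) => //= uS; case: (boolP (v \in S)) => //= vS.
by rewrite inE; apply: connect1; rewrite /avoid /= uv uS.
Qed.

Lemma sum_closure_in (f : G -> R) u : u \in S ->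
  \sum_(v | closure_adj u v) f v = \sum_(v in S) f v - f u + \sum_(v in ~: S) f v.
Proof.
move=> uS; rewrite [\sum_(v in S) f v](bigD1 u) //= [f u + _]addrC addrK.
rewrite (bigID (mem S)) /=; congr (_ + _); apply: eq_bigl => v; rewrite /closure_adj /=.
  by rewrite uS /= andbT eq_sym andbC.
rewrite uS /= andbT finset.in_setC; case: (eqVneq u v) => //= <-.
by rewrite uS.
Qed.

Lemma sum_closure_out (f : G -> R) u : u \notin S ->
  \sum_(v | closure_adj u v) f v = \sum_(v in S) f v + \sum_(v in component u) f v - f u.
Proof.
move=> uS; rewrite [\sum_(v in component u) _](bigD1 u) ?mem_component //= [f u + _]addrC addrA addrK.
rewrite (bigID (mem S)) /=; congr (_ + _); apply: eq_bigl => v; rewrite /closure_adj /=.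
  rewrite (negbTE uS) /=; case: (boolP (v \in S)) => vS; rewrite ?andbT ?andbF //=.
  by apply: contraNneq uS => ->.
rewrite (negbTE uS) /= eq_sym; case: (boolP (v \in component u)) => vu.
  by rewrite (negbTE (component_notin uS vu)) /= ?andbT.
by case: (v \in S); rewrite ?andbF.
Qed.

Lemma sum_closure_adj (f : G -> R) u :
  \sum_(v | closure_adj u v) f v =
  \sum_(v | adj u v) f v + \sum_(v | closure_adj u v && ~~ adj u v) f v.
Proof.
rewrite (bigID (adj u)) /=; congr (_ + _).
by apply: eq_bigl => v; rewrite andb_idl //; exact: adj_closure.
Qed.

(** [M] is the order of the large component when [G - S] consists of [p] isolated
    vertices and one other component, and the hypothesis [row] is the row of a
    vertex of [S] in [B x <= lam x] for that configuration. *)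
Variables (c mu : R).
Let s : R := #|S|%:R.
Let M : R := #|~: S|%:R - p%:R.
Let lam : R := (1 + c) * (mu - 1) + c * s.
Hypotheses (c0 : 0 <= c) (S0 : S != finset.set0) (muM : M < mu).
Hypothesis row : c * (#|G|%:R - 1) + (s - 1)
  + s / (1 + c) * (p%:R / (mu - 1) + M / (mu - M)) <= lam.
Hypothesis G_conn : connected G.

Definition test_vector (v : G) : R :=
  if v \in S then 1 else s / (1 + c) / (mu - #|component v|%:R).

Let e0 : 0 < 1 + c. Proof. exact: ltr_pwDl. Qed.
Let s0 : 0 < s. Proof. by rewrite /s ltr0n card_gt0. Qed.

Let component_le v : v \notin S -> 1 <= (#|component v|%:R : R) <= M.
Proof.
move=> vS; rewrite ler1n component_card_gt0 /= /M lerBrDr -natrD ler_nat.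
exact: component_card.
Qed.

Let M1 : 1 <= M.
Proof.
have [x xX] : exists x, x \in X by apply/card_gt0P; exact: leq_trans X_card.
have xS : x \notin S by case: X_scat => XS _; exact: XS.
by have /andP[] := component_le xS; exact: le_trans.
Qed.

Let mu_component v : v \notin S -> 0 < mu - #|component v|%:R.
Proof. by move/component_le/andP=> [_ h]; rewrite subr_gt0 (le_lt_trans h). Qed.

Lemma test_vector_gt0 v : 0 < test_vector v.
Proof. by rewrite /test_vector; case: ifP => // /negbT vS; rewrite !divr_gt0 // mu_component. Qed.

Lemma sum_test_S : \sum_(v in S) test_vector v = s.
Proof.
rewrite (eq_bigr (fun=> 1)); last by move=> v vS; rewrite /test_vector vS.
by rewrite sumr_const.
Qed.

Lemma sum_test_component u : u \notin S ->
  \sum_(v in component u) test_vector v = #|component u|%:R * test_vector u.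
Proof.
move=> uS; rewrite (eq_bigr (fun=> test_vector u)); last first.
  by move=> v vu; rewrite /test_vector (negbTE uS) (negbTE (component_notin uS vu)) (component_eq vu).
by rewrite sumr_const mulr_natl.
Qed.

Let sig : R := mu / ((mu - M) * (mu - 1)).
Let kap : R := M / ((mu - M) * (mu - 1)).

Let D0 : 0 < (mu - M) * (mu - 1).
Proof. by rewrite mulr_gt0 // subr_gt0 // (le_lt_trans M1). Qed.

(** For [1 <= m <= M], [1 / (mu - m)] lies below [sig - kap / m], and the
    difference [gap m] vanishes exactly at [m = 1] and [m = M].  Summed over the
    vertices outside [S], this bound depends only on the number of vertices and
    the number of components. *)
Let gap (m : R) : R :=
  mu * (m - 1) * (M - m) / (m * (mu - m) * ((mu - M) * (mu - 1))).

Let inv_component v : v \notin S ->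
  (mu - #|component v|%:R)^-1 = sig - kap / #|component v|%:R - gap #|component v|%:R.
Proof.
move=> vS; have := mu_component vS; have /andP[] := component_le vS.
rewrite /gap; move: (#|component v|%:R) => m m1 mM mum; rewrite /sig /kap; field.
have muM0 : 0 < mu - M by rewrite subr_gt0.
have mu10 : 0 < mu - 1 by lra.
by rewrite !gt_eqF //; lra.
Qed.

Let gap_ge0 v : v \notin S -> 0 <= gap #|component v|%:R.
Proof.
move=> vS; have := mu_component vS; have /andP[] := component_le vS.
rewrite /gap; move: (#|component v|%:R) => m m1 mM mum.
have m0 : 0 < m by lra.
have mu0 : 0 <= mu by lra.
apply: divr_ge0; first by rewrite !mulr_ge0 ?subr_ge0.
by rewrite ltW // mulr_gt0 // mulr_gt0.
Qed.

Let gap_eq0 v : v \notin S -> gap #|component v|%:R = 0 ->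
  #|component v|%:R = 1 :> R \/ #|component v|%:R = M.
Proof.
move=> vS; have := mu_component vS; have /andP[] := component_le vS.
rewrite /gap; move: (#|component v|%:R) => m m1 mM mum /eqP.
have m0 : 0 < m by lra.
have mu0 : 0 < mu by lra.
rewrite mulf_eq0 invr_eq0 !mulf_eq0 !(gt_eqF m0, gt_eqF mum, gt_eqF mu0) /=.
have := D0; rewrite lt0r mulf_eq0 => /andP[/negbTE-> _]; rewrite orbF.
by case/orP; rewrite subr_eq0 => /eqP; [left | right].
Qed.

Let excess_comps : R := \sum_(v in ~: S) (#|component v|%:R)^-1 - (p%:R + 1).
Let total_gap : R := \sum_(v in ~: S) gap #|component v|%:R.

Lemma sum_test_out : \sum_(v in ~: S) test_vector v =
  s / (1 + c) * (p%:R / (mu - 1) + M / (mu - M) - kap * excess_comps - total_gap).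
Proof.
rewrite (eq_bigr (fun v => s / (1 + c) * (sig - kap / #|component v|%:R - gap #|component v|%:R))).
  rewrite -mulr_sumr; congr (_ * _).
  have -> : \sum_(v in ~: S) (sig - kap / #|component v|%:R - gap #|component v|%:R)
          = (M + p%:R) * sig - kap * (excess_comps + (p%:R + 1)) - total_gap.
    rewrite !sumrB; congr (_ - _ - _); last by rewrite -mulr_sumr /excess_comps subrK.
    by rewrite sumr_const -[LHS]mulr_natl /M subrK.
  rewrite /sig /kap; field.
  have muM0 : 0 < mu - M by rewrite subr_gt0.
  have mu10 : 0 < mu - 1 by have := M1; lra.
  by rewrite !gt_eqF.
move=> v; rewrite finset.in_setC => vS; rewrite /test_vector (negbTE vS) -inv_component //.
Qed.

Let kap0 : 0 < kap.
Proof. by rewrite divr_gt0 // (lt_le_trans ltr01). Qed.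

Let excess_comps_ge0 : 0 <= excess_comps.
Proof.
rewrite subr_ge0; apply: le_trans sum_inv_component.
by rewrite natr1 ler_nat.
Qed.

Let total_gap_ge0 : 0 <= total_gap.
Proof. by apply: sumr_ge0 => v; rewrite finset.in_setC; exact: gap_ge0. Qed.

Definition act_closure (w : G) : R :=
  c * (\sum_(v | closure_adj w v) 1) * test_vector w + \sum_(v | closure_adj w v) test_vector v.

Lemma act_closureE w : act_closure w = act c test_vector w
  + (c * (\sum_(v | closure_adj w v && ~~ adj w v) 1) * test_vector w
  + \sum_(v | closure_adj w v && ~~ adj w v) test_vector v).
Proof. by rewrite /act_closure /act degreeE !sum_closure_adj; ring. Qed.

(** The choice of [test_vector] makes the rows outside [S] equalities. *)
Lemma act_closure_out w : w \notin S -> act_closure w = lam * test_vector w.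
Proof.
move=> wS; rewrite /act_closure !sum_closure_out // sum_test_S sum_test_component //.
rewrite !sumr_const /test_vector (negbTE wS); have := mu_component wS.
rewrite /lam -/s; move: (#|component w|%:R) => m mum; field.
by rewrite !gt_eqF.
Qed.

Lemma act_closure_in w : w \in S -> act_closure w =
  c * (#|G|%:R - 1) + (s - 1)
  + s / (1 + c) * (p%:R / (mu - 1) + M / (mu - M))
  - s / (1 + c) * (kap * excess_comps + total_gap).
Proof.
move=> wS; rewrite /act_closure !sum_closure_in // sum_test_S sum_test_out /test_vector wS.
rewrite !sumr_const -/s.
have -> : #|G|%:R = s + #|~: S|%:R :> R by rewrite /s -natrD cardsC.
ring.
Qed.

Lemma act_closure_le w : act_closure w <= lam * test_vector w.
Proof.
case: (boolP (w \in S)) => wS; last by rewrite act_closure_out.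
rewrite act_closure_in // /test_vector wS mulr1; apply: le_trans row.
rewrite gerBl mulr_ge0 //; first by rewrite ltW // divr_gt0.
by rewrite addr_ge0 // mulr_ge0 // ltW.
Qed.

Let defect_ge0 w : 0 <= c * (\sum_(v | closure_adj w v && ~~ adj w v) 1) * test_vector w
  + \sum_(v | closure_adj w v && ~~ adj w v) test_vector v.
Proof.
have t0 v := ltW (test_vector_gt0 v).
by rewrite addr_ge0 ?mulr_ge0 ?sumr_ge0.
Qed.

Lemma act_le w : act c test_vector w <= lam * test_vector w.
Proof. by apply: le_trans (act_closure_le w); rewrite act_closureE lerDl. Qed.

(** An eigenvalue at least [lam] leaves no slack at all: [G] has all the edges
    of [closure_adj], and every component of [G - S] has order 1 or [M]. *)
Lemma comparison (a : R) : eigenvalue (deg_adj c G) a -> lam <= a ->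
  [/\ c * (#|G|%:R - 1) + (s - 1)
         + s / (1 + c) * (p%:R / (mu - 1) + M / (mu - M)) = lam,
      forall u v, u \in S -> u != v -> adj u v &
      exists B : {set G}, [/\ [disjoint B & S], (#|B| + p = #|~: S|)%N &
        forall u v, u \in B -> v \in B -> u != v -> adj u v]].
Proof.
move=> Ga lam_a.
have tight w : act c test_vector w = lam * test_vector w.
  apply/eqP; rewrite eq_le act_le /= leNgt; apply/negP => lt.
  have := eigenvalue_lt_of_supersolution c0 G_conn test_vector_gt0 act_le lt Ga.
  by rewrite ltNge lam_a.
have closure_adj_tight u v : closure_adj u v -> adj u v.
  move=> uv; apply/negPn/negP => nuv.
  have := act_closure_le u; rewrite act_closureE tight gerDl => le0.
  have : 0 < \sum_(v | closure_adj u v && ~~ adj u v) test_vector v.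
    rewrite (bigD1 v) ?uv //= ltr_pwDl ?test_vector_gt0 // sumr_ge0 // => w _.
    exact/ltW/test_vector_gt0.
  have : 0 <= c * (\sum_(v | closure_adj u v && ~~ adj u v) 1) * test_vector u.
    by rewrite !mulr_ge0 ?sumr_ge0 // ltW ?test_vector_gt0.
  lra.
have act_closureT w : act_closure w = lam * test_vector w.
  by apply/eqP; rewrite eq_le act_closure_le /= -tight act_closureE lerDl; exact: defect_ge0.
have /set0Pn[w wS] := S0.
have := act_closureT w; rewrite act_closure_in // /test_vector wS mulr1.
have se0 : 0 < s / (1 + c) by rewrite divr_gt0.
have k1 : 0 <= kap * excess_comps by rewrite mulr_ge0 // ltW.
have d0 : 0 <= s / (1 + c) * (kap * excess_comps + total_gap).
  by rewrite mulr_ge0 ?addr_ge0 // ltW.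
move=> rowE; have zero : s / (1 + c) * (kap * excess_comps + total_gap) = 0.
  have := row; lra.
split; first by rewrite -rowE zero subr0.
  by move=> u v uS uv; apply: closure_adj_tight; rewrite /closure_adj /= uv uS.
move/eqP: zero; rewrite mulf_eq0 gt_eqF //= paddr_eq0 // mulf_eq0 gt_eqF //=.
move=> /andP[/eqP e_comps /eqP gap0].
have gapv v : v \notin S -> gap #|component v|%:R = 0.
  move=> vS; apply: (psumr_eq0P _ gap0); last by rewrite finset.in_setC.
  by move=> u; rewrite finset.in_setC; exact: gap_ge0.
(* If all components are single vertices, there are p + 1 of them and M = 1. *)
have [v vS vM] : exists2 v, v \notin S & #|component v|%:R = M.
  apply: contrapT => no.
  have all1 v : v \notin S -> #|component v|%:R = 1 :> R.
    by move=> vS; case: (gap_eq0 vS (gapv _ vS)) => // vM; case: no; exists v.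
  have M_1 : M = 1.
    move: e_comps; rewrite /excess_comps (eq_bigr (fun=> 1)) ?sumr_const.
      by rewrite /M; lra.
    by move=> v; rewrite finset.in_setC => /all1->; rewrite invr1.
  have [x xX] : exists x, x \in X by apply/card_gt0P; exact: leq_trans X_card.
  have xS : x \notin S by case: X_scat => XS _; exact: XS.
  by case: no; exists x; rewrite // M_1 all1.
exists (component v); split.
- by rewrite disjoint_subset; apply/fintype.subsetP => u uv; exact: (component_notin vS uv).
- by apply/eqP; rewrite -(eqr_nat R) natrD vM /M subrK.
move=> u u' uv u'v uu'; apply: closure_adj_tight; rewrite /closure_adj /= uu' (component_eq uv) u'v.
by rewrite !orbT.
Qed.

End Compare.

(** * Inequalities between real parameters *)

Section Inequalities.
Local Open Scope ring_scope.

(** Strictness of the row for a set [S] with [s = s0 + d] vertices at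
    [lam = Y - 1], in the adjacency case; here [Y] is the clique
    number of the extremal graph for [s0] and [j = k - 2].  After clearing
    denominators, the factor [Y - 1] of the larger side is at least the factor
    [Y - M] of the other. *)
Lemma row_strict0 (R : realFieldType) (j s0 d M : R) :
  1 <= j -> 2 <= s0 -> 1 <= d -> 1 <= M ->
  let s := s0 + d in let Y := M + s + d * j in
  s * (s * j + 2) < d * j * Y ->
  s - 1 + s * ((s * j + 2) / (Y - 1) + M / (Y - M)) < Y - 1.
Proof.
move=> j1 s2 d1 M1 s Y key.
have dj : 1 <= d * j by nra.
have X0 : 0 < Y - M by rewrite /Y /s; lra.
have Y1 : Y - M <= Y - 1 by lra.
have Y0 : 0 < Y - 1 by lra.
have sj0 : 0 < s * (s * j + 2) by rewrite /s; nra.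
have key2 : s * (s * j + 2) * (Y - M) < d * j * Y * (Y - 1) by nra.
rewrite -subr_gt0.
have -> : Y - 1 - (s - 1 + s * ((s * j + 2) / (Y - 1) + M / (Y - M))) =
   (d * j * Y * (Y - 1) - s * (s * j + 2) * (Y - M)) / ((Y - 1) * (Y - M)).
  rewrite /Y in X0 Y0 *; field; rewrite !gt_eqF //=; lra.
by rewrite divr_gt0 ?mulr_gt0 // subr_gt0.
Qed.

(** The same for the signless Laplacian at [lam = 2 (Y - 1)].  With
    [mu - M = Z / 2] and [mu - 1 = W / 2], where [Z <= W], it is enough to prove
    the inequality with [Z (W + s)] replaced by the larger [W (Z + s)]. *)
Lemma row_strict1 (R : realFieldType) (j s0 d M : R) :
  1 <= j -> 2 <= s0 -> 1 <= d -> 1 <= M ->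
  let s := s0 + d in let Y := M + s + d * j in let mu := Y - s / 2 in
  s * (s * j + 2) < d * j * (Y - (s0 * j + 2)) ->
  M + s * (j + 1) + 2 - 1 + (s - 1) +
    s / 2 * ((s * j + 2) / (mu - 1) + M / (mu - M)) < 2 * (mu - 1) + s.
Proof.
move=> j1 s2 d1 M1 s Y mu key.
have dj : 1 <= d * j by nra.
pose Z := s + 2 * d * j; pose W := 2 * M + Z - 2.
have Z0 : 0 < Z by rewrite /Z /s; lra.
have WZ : Z <= W by rewrite /W; lra.
have W0 : 0 < W by lra.
have s0' : 0 < s by rewrite /s; lra.
have sj0 : 0 < s * j + 2 by nra.
have key2 : (Z + s) * (s * j + 2) < 2 * (d * j) * (M + Z).
  by move: key; rewrite /Z /Y /s; lra.
have key3 : Z * (s * j + 2) * (W + s) < 2 * (d * j) * (M + Z) * W.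
  have : Z * (W + s) <= W * (Z + s) by nra.
  nra.
rewrite -subr_gt0.
have -> : 2 * (mu - 1) + s - (M + s * (j + 1) + 2 - 1 + (s - 1) +
    s / 2 * ((s * j + 2) / (mu - 1) + M / (mu - M))) =
   (2 * (d * j) * (M + Z) * W - Z * (s * j + 2) * (W + s)) / (Z * W).
  have -> : mu - 1 = W / 2 by rewrite /mu /Y /W /Z; field.
  have -> : mu - M = Z / 2 by rewrite /mu /Y /W /Z; field.
  have Ws : W = 2 * M + s + 2 * d * j - 2 by rewrite /W /Z; ring.
  rewrite /Z Ws in Z0 W0 *; field; rewrite !gt_eqF //=.
by rewrite divr_gt0 ?mulr_gt0 // subr_gt0.
Qed.

(** A concave quadratic is positive between two points where it is. *)
Lemma concave_pos (R : realFieldType) (A B D d : R) :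
  1 <= d -> d <= D -> B < A - 1 -> B < D * (A - D) -> B < d * (A - d).
Proof.
move=> d1 dD h1 hD; case: (eqVneq D 1) => [D1|Dn1].
  have -> : d = 1 by lra.
  by rewrite mul1r.
have D1 : 0 < D - 1 by rewrite lt_neqAle eq_sym subr_eq0 Dn1 subr_ge0; lra.
have ends : 0 < (D - d) * (A - 1 - B) + (d - 1) * (D * (A - D) - B).
  case: (eqVneq d D) => [->|dDn].
    rewrite subrr mul0r add0r mulr_gt0 //; lra.
  have dD' : 0 < D - d by rewrite lt_neqAle eq_sym subr_eq0 eq_sym dDn subr_ge0.
  rewrite ltr_pwDl ?mulr_gt0 // ?mulr_ge0 //; lra.
have : 0 < (D - 1) * (d * (A - d) - B).
  have -> : (D - 1) * (d * (A - d) - B) = (D - d) * (A - 1 - B)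
      + (d - 1) * (D * (A - D) - B) + (D - 1) * ((d - 1) * (D - d)) by ring.
  by rewrite ltr_pwDl // !mulr_ge0 //; lra.
by rewrite pmulr_rgt0 // subr_gt0.
Qed.

(** Divided by [j], the claim says that the concave quadratic
    [d (Y - 2 s0 - 2 / j - d) - s0 (s0 + 2 / j)] in [d] is positive.  It is
    enough to check [d = 1] and the largest possible value [D] of [d], which is
    reached when [M = 1]. *)
Lemma extra_vertices_ineq0 (R : realFieldType) (j s0 d M : R) :
  1 <= j -> s0 = 2 \/ s0 = 3 -> 1 <= d -> 1 <= M ->
  let s := s0 + d in let Y := M + s + d * j in
  (s0 + 1) * (j + 2) + s0 + 3 + (2 * s0 + 5) / j + 4 / j ^+ 2 <= Y + s0 * j + 2 ->
  s * (s * j + 2) < d * j * Y.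
Proof.
move=> j1 s0E d1 M1 s Y hN.
have j0 : 0 < j by lra.
pose i := j^-1; have ij : i * j = 1 by rewrite mulVf // gt_eqF.
have i0 : 0 < i by rewrite invr_gt0.
have i1 : i <= 1 by nra.
have {}hN : j + 3 * s0 + 3 + (2 * s0 + 5) * i + 4 * (i * i) <= Y.
  move: hN; rewrite expr2 invfM -/i; lra.
suff : s0 * (s0 + 2 * i) < d * ((Y - 2 * s0 - 2 * i) - d).
  have -> : d * j * Y = j * (d * (Y - 2 * s0 - 2 * i - d)) + d * j * (2 * s0)
      + 2 * d * (i * j) + j * d * d by ring.
  rewrite ij; set T := d * (_ - d) => hT.
  have : j * (s0 * (s0 + 2 * i)) < j * T by rewrite ltr_pM2l.
  have -> : j * (s0 * (s0 + 2 * i)) = j * s0 * s0 + 2 * s0 * (i * j) by ring.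
  rewrite ij /s; lra.
pose D := (Y - s0 - 1) / (j + 1).
have YD : Y = D * (j + 1) + s0 + 1 by rewrite /D; field; rewrite gt_eqF //; lra.
have D_ge : 1 + (2 * s0 + 1) * i + 4 * (i * i) <= D.
  rewrite /D ler_pdivlMr; last lra.
  apply: le_trans (_ : j + 2 * s0 + 2 + (2 * s0 + 5) * i + 4 * (i * i) <= _); last lra.
  have -> : (1 + (2 * s0 + 1) * i + 4 * (i * i)) * (j + 1)
     = j + 1 + (2 * s0 + 1) * (i * j + i) + 4 * i * (i * j) + 4 * (i * i) by ring.
  rewrite ij; lra.
apply: (concave_pos (D := D)) => //.
- by rewrite /D ler_pdivlMr; [rewrite /Y /s; lra | lra].
- case: s0E hN => -> hN; first by nra.
  case: (lerP 4 j) => j4; first by nra.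
  have e : j - 4 + 4 * i = i * (j - 2) ^+ 2.
    have -> : i * (j - 2) ^+ 2 = (i * j) * j - 4 * (i * j) + 4 * i by ring.
    by rewrite ij; ring.
  have e0 : 0 <= i * (j - 2) ^+ 2 by rewrite mulr_ge0 ?sqr_ge0 // ltW.
  have i4 : 1 < 4 * i by nra.
  nra.
have Dj : j + 2 * s0 + 1 + 4 * i <= D * j.
  have : (1 + (2 * s0 + 1) * i + 4 * (i * i)) * j <= D * j by rewrite ler_pM2r.
  have -> : (1 + (2 * s0 + 1) * i + 4 * (i * i)) * j
     = j + (2 * s0 + 1) * (i * j) + 4 * i * (i * j) by ring.
  rewrite ij; lra.
apply: lt_le_trans (_ : (1 + (2 * s0 + 1) * i) * (j + s0 + 2) <= _); last first.
  apply: ler_pM; first by case: s0E => ->; lra.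
  - by case: s0E => ->; lra.
  - nra.
  - rewrite YD; lra.
have -> : (1 + (2 * s0 + 1) * i) * (j + s0 + 2)
  = j + s0 + 2 + (2 * s0 + 1) * (i * j) + (2 * s0 + 1) * (s0 + 2) * i by ring.
by rewrite ij; case: s0E => ->; lra.
Qed.

(** As for the adjacency case, with [Y] lowered by [s0 j + 2] in the quadratic. *)
Lemma extra_vertices_ineq1 (R : realFieldType) (j s0 d M : R) :
  1 <= j -> s0 = 2 \/ s0 = 3 -> 1 <= d -> 1 <= M ->
  let s := s0 + d in let Y := M + s + d * j in
  1 / 2 * (s0 + 1) ^+ 2 * (j + 2) + (3 * s0 + 5) / 2 + (2 * s0 + 3) / j <= Y + s0 * j + 2 ->
  s * (s * j + 2) < d * j * (Y - (s0 * j + 2)).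
Proof.
move=> j1 s0E d1 M1 s Y hN.
have j0 : 0 < j by lra.
pose i := j^-1; have ij : i * j = 1 by rewrite mulVf // gt_eqF.
have i0 : 0 < i by rewrite invr_gt0.
have i1 : i <= 1 by nra.
move: hN; rewrite -/i => hN.
suff : s0 * (s0 + 2 * i) < d * ((Y - (s0 * j + 2) - 2 * s0 - 2 * i) - d).
  have -> : d * j * (Y - (s0 * j + 2))
      = j * (d * (Y - (s0 * j + 2) - 2 * s0 - 2 * i - d)) + d * j * (2 * s0)
        + 2 * d * (i * j) + j * d * d by ring.
  rewrite ij; set T := d * (_ - d) => hT.
  have : j * (s0 * (s0 + 2 * i)) < j * T by rewrite ltr_pM2l.
  have -> : j * (s0 * (s0 + 2 * i)) = j * s0 * s0 + 2 * s0 * (i * j) by ring.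
  rewrite ij /s; lra.
pose D := (Y - s0 - 1) / (j + 1).
have YD : Y = D * (j + 1) + s0 + 1 by rewrite /D; field; rewrite gt_eqF //; lra.
have dD : d <= D by rewrite /D ler_pdivlMr; [rewrite /Y /s; lra | lra].
apply: (concave_pos (D := D)) => //.
  by case: s0E hN => ->; lra.
have prod_lt (u v w : R) : 0 <= u -> 0 <= v -> u <= D ->
    v <= Y - (s0 * j + 2) - 2 * s0 - 2 * i - D -> w < u * v ->
    w < D * (Y - (s0 * j + 2) - 2 * s0 - 2 * i - D).
  by move=> u0 v0 uD vA; move/lt_le_trans; apply; apply: ler_pM.
case: s0E => s0E; rewrite s0E in hN YD prod_lt *.
  have D_ge : 5 / 2 + 7 * i <= D.
    rewrite -(ler_pM2r (_ : 0 < j + 1)); last lra.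
    have -> : (5 / 2 + 7 * i) * (j + 1) = 5 / 2 * j + 5 / 2 + 7 * (i * j) + 7 * i by field.
    rewrite ij; lra.
  have Dj : 5 / 2 * j + 7 <= D * j.
    have : (5 / 2 + 7 * i) * j <= D * j by rewrite ler_pM2r.
    have -> : (5 / 2 + 7 * i) * j = 5 / 2 * j + 7 * (i * j) by ring.
    by rewrite ij mulr1.
  apply: (prod_lt (5 / 2 + 7 * i) (1 / 2 * j + 4 - 2 * i)) => //; try lra.
  have -> : (5 / 2 + 7 * i) * (1 / 2 * j + 4 - 2 * i)
    = 5 / 4 * j + 10 + 23 * i + 7 / 2 * (i * j) - 14 * (i * i) by field.
  rewrite ij; nra.
have D_ge : 5 + 9 * i <= D.
  rewrite -(ler_pM2r (_ : 0 < j + 1)); last lra.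
  have -> : (5 + 9 * i) * (j + 1) = 5 * j + 5 + 9 * (i * j) + 9 * i by field.
  rewrite ij; lra.
have Dj : 5 * j + 9 <= D * j.
  have : (5 + 9 * i) * j <= D * j by rewrite ler_pM2r.
  have -> : (5 + 9 * i) * j = 5 * j + 9 * (i * j) by ring.
  by rewrite ij mulr1.
apply: (prod_lt (5 + 9 * i) (2 * j + 5 - 2 * i)) => //; try lra.
have -> : (5 + 9 * i) * (2 * j + 5 - 2 * i)
  = 10 * j + 25 + 35 * i + 18 * (i * j) - 18 * (i * i) by ring.
rewrite ij; nra.
Qed.

(** The eigenvalue equation of the extremal graph in the variable [mu].  After
    clearing denominators it is a cubic that changes sign between [M + t] and
    [p + M + t], where [t = s / (1 + c)]; the left end corresponds to the
    largest eigenvalue of the clique of order [M + s]. *)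
Lemma extremal_row_root (R : rcfType) (c s p M : R) : 0 <= c ->
  2 <= s -> 0 <= p -> 1 <= M ->
  exists mu : R, [/\ M + s - c * s / (1 + c) <= mu, M < mu &
    c * (s + p + M - 1) + (s - 1) + s / (1 + c) * (p / (mu - 1) + M / (mu - M))
    = (1 + c) * (mu - 1) + c * s].
Proof.
move=> c0 s2 p0 M1.
pose e := 1 + c; pose t := s / e.
have e0 : 0 < e by rewrite /e; lra.
have t0 : 0 < t by rewrite divr_gt0 //; lra.
have ct : s - c * s / (1 + c) = t by rewrite /t /e; field; rewrite gt_eqF.
(* The constant is kept opaque so that evaluation of P does not expand it. *)
have [K KE] : exists K, K = c * s - e - c * (s + p + M - 1) - (s - 1) by eexists.
pose P : {poly R} := (e *: 'X + K%:P)
   * ('X - 1%:P) * ('X - M%:P) - t *: (p *: ('X - M%:P) + M *: ('X - 1%:P)).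
have PE x : P.[x] = (e * (x - 1) + c * s - c * (s + p + M - 1) - (s - 1)) * (x - 1) * (x - M)
    - t * (p * (x - M) + M * (x - 1)).
  by rewrite /P !hornerE KE; ring.
pose a := M + t; pose b := p + M + t.
have es : e * t = s by rewrite /t mulrC mulfVK // gt_eqF.
have Pa : P.[a] <= 0.
  rewrite PE /a.
  have -> : (e * (M + t - 1) + c * s - c * (s + p + M - 1) - (s - 1)) * (M + t - 1) * (M + t - M)
     - t * (p * (M + t - M) + M * (M + t - 1)) = (e * t - s) * (M + t - 1) * t - t * p * (c * (M + t - 1) + t).
    by rewrite /e; ring.
  rewrite es subrr !mul0r sub0r oppr_le0 mulr_ge0 //.
    by rewrite mulr_ge0 // ltW.
  by rewrite addr_ge0 ?(ltW t0) // mulr_ge0 //; lra.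
have Pb : 0 <= P.[b].
  rewrite PE /b.
  have -> : (e * (p + M + t - 1) + c * s - c * (s + p + M - 1) - (s - 1)) * (p + M + t - 1) * (p + M + t - M)
     - t * (p * (p + M + t - M) + M * (p + M + t - 1)) =
     (e * t - s) * (p + M + t - 1) * (p + t) + M * (p + M + t - 1) * p + p * (p + t) * (p + M - 1).
    by rewrite /e; ring.
  rewrite es subrr !mul0r add0r.
  by rewrite addr_ge0 ?mulr_ge0 //; lra.
have ab : a <= b by rewrite /a /b; lra.
have Pab : P.[a] <= 0 <= P.[b] by rewrite Pa Pb.
have [mu /andP[amu _] /rootP rmu] := Num.Theory.poly_ivt ab Pab.
have Mmu : M < mu by rewrite /a in amu; lra.
exists mu; split=> //; first by rewrite -addrA ct.
have mM : 0 < mu - M by lra.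
have m1 : 0 < mu - 1 by lra.
apply/eqP; rewrite -subr_eq0; apply/eqP.
have -> : c * (s + p + M - 1) + (s - 1) + s / (1 + c) * (p / (mu - 1) + M / (mu - M)) -
  ((1 + c) * (mu - 1) + c * s) = - P.[mu] / ((mu - 1) * (mu - M)).
  by rewrite PE -/e -/t; field; rewrite !gt_eqF.
by rewrite rmu oppr0 mul0r.
Qed.

End Inequalities.

(** * Toughness and the final comparison *)

Local Open Scope ring_scope.

Lemma scattered_le_components (G : sgraph) (S X : {set G}) :
  scattered S X -> (#|X| <= num_components (delete S))%N.
Proof.
move=> [XS X_sep]; pose X' : {set delete S} := [set y | val y \in X].
have cX : #|X'| = #|X|.
  rewrite -(card_imset _ val_inj); apply: eq_card => x; apply/imsetP/idP.
    by case=> y; rewrite inE => yX ->.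
  move=> xX; have xS : x \in ~: S by rewrite finset.in_setC XS.
  by exists (Sub x xS); rewrite ?inE SubK.
have csym := sym_connect_sym (@adj_sym (delete S)).
have conn (y z : delete S) : connect (@adj (delete S)) y z ->
    connect (avoid (@adj G) S) (val y) (val z).
  case/connectP=> q; elim: q y => [|w q IH] y /=; first by move=> _ ->.
  move=> /andP[yw wq] lq; apply: connect_trans (IH _ wq lq).
  apply: connect1; rewrite /avoid /=.
  by rewrite -!finset.in_setC (valP y) (valP w) !andbT.
rewrite -cX -(@card_in_imset _ _ (fingraph.root (@adj (delete S)))) => [|y z].
  apply: subset_leq_card; apply/fintype.subsetP => z /imsetP[y _ ->].
  by rewrite !inE roots_root.
rewrite !inE => yX zX /eqP; rewrite root_connect // => /conn yz.
by apply: val_inj; exact: X_sep yz.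
Qed.

(** [s (t (k - 1) + 1) >= t ((k - 2) s + 3)] simplifies to [s (t + 1) >= 3 t]. *)
Lemma tough_card_ge (R : realType) (k t s0 : nat) (G : sgraph) (S X : {set G}) :
  (3 <= k)%N -> (1 <= t)%N -> s0%:Z = Num.ceil ((3 * t%:R) / (t%:R + 1) : R) ->
  tough (t%:R / (t%:R * (k%:R - 1) + 1) : R) G ->
  scattered S X -> ((k - 2) * #|S| + 3 <= #|X|)%N -> (s0 <= #|S|)%N.
Proof.
move=> k3 t1 s0E tG SX cX.
have cD := leq_trans cX (scattered_le_components SX).
have := tG S (leq_trans _ cD); rewrite addn3 => /(_ isT).
have kE : k%:R = (k - 2)%:R + 2 :> R by rewrite -natrD subnK // ltnW.
have cR : (k - 2)%:R * #|S|%:R + 3 <= (num_components (delete S))%:R :> R.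
  by rewrite -natrM -natrD ler_nat.
have t0 : 1 <= t%:R :> R by rewrite ler1n.
move: cR; move: (num_components (delete S)) => m cR.
have j1 : 1 <= (k - 2)%:R :> R by rewrite ler1n; lia.
rewrite kE; set j : R := (k - 2)%:R in cR j1 *; set T : R := t%:R in t0 s0E *.
set s : R := #|S|%:R in cR *.
have D0 : 0 < T * (j + 2 - 1) + 1 by nra.
rewrite mulrAC ler_pdivrMr // => h.
rewrite -lez_nat s0E ceil_le_int // ler_pdivrMr; last lra.
have : T * (j * s + 3) <= T * m%:R by rewrite ler_pM2l; lra.
rewrite -[_%:~R]/s; nra.
Qed.

Lemma ceil_two_or_three (R : realType) (t s0 : nat) : (1 <= t)%N ->
  s0%:Z = Num.ceil ((3 * t%:R) / (t%:R + 1) : R) -> (s0 = 2 \/ s0 = 3)%N.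
Proof.
move=> t1 s0E; have t0 : 1 <= t%:R :> R by rewrite ler1n.
have : (s0%:Z <= 3)%R.
  rewrite s0E ceil_le_int // ler_pdivrMr; last lra.
  rewrite -[_%:~R]/(3%:R); lra.
have : (1 < s0%:Z)%R.
  rewrite s0E ceil_gt_int // ltr_pdivlMr; last lra.
  rewrite -[_%:~R]/(1%:R); lra.
lia.
Qed.

(** The final comparison, given a scattering set and the inequality that the
    lower bound on the order provides for sets with [d] more vertices than [s0]. *)
Lemma spectral_ktree (R : realType) (c : R) (j s0 : nat) (G : sgraph) (S X : {set G}) :
  c = 0 \/ c = 1 -> (1 <= j)%N -> (2 <= s0)%N -> (s0 <= #|S|)%N -> connected G ->
  scattered S X -> (j * #|S| + 3 <= #|X|)%N ->
  (forall d M : R, 1 <= d -> 1 <= M ->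
     let s := s0%:R + d in let Y := M + s + d * j%:R in
     #|G|%:R = Y + s0%:R * j%:R + 2 ->
     s * (s * j%:R + 2) < d * j%:R * (Y - c * (s0%:R * j%:R + 2))) ->
  largest_eigenvalue (deg_adj c (extremal #|G| j.+2 s0)) <= largest_eigenvalue (deg_adj c G) ->
  has_spanning_ktree j.+2 G.
Proof.
move=> cE j1 s2 s0s Gc SX cX key le_eig.
have c0 : 0 <= c by case: cE => ->.
have e0 : 0 < 1 + c by lra.
have XN : (#|X| <= #|~: S|)%N.
  case: SX => XS _; apply: subset_leq_card; apply/fintype.subsetP => x xX.
  by rewrite finset.in_setC XS.
have nE : (#|S| + #|~: S| = #|G|)%N by rewrite cardsC.
have S0 : S != finset.set0 by rewrite -card_gt0; lia.
pose m := (#|G| - s0 * (j.+2 - 1) - 2)%N.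
pose p := (s0 * (j.+2 - 2) + 2)%N.
have pE : p = (s0 * j + 2)%N by rewrite /p; lia.
have mE : (#|G| = m + s0 * j + s0 + 2)%N by rewrite /m; nia.
have m1 : (1 <= m)%N by rewrite /m; nia.
have NE : #|S| = s0 -> #|~: S| = (m + p)%N by lia.
have qX : (#|S| * j + 2 < #|X|)%N by lia.
have qN : (1 + (#|S| * j + 2) <= #|~: S|)%N by lia.
have restE (B : {set G}) : #|S| = s0 -> S :&: B = finset.set0 -> (#|B| + p = #|~: S|)%N ->
    (#|~: (S :|: B)| <= #|S| * (j.+2 - 2) + 2)%N.
  move=> sE SB cB; have := cardsC (S :|: B); have := cardsUI S B.
  by rewrite SB cards0; lia.
have m1R : 1 <= m%:R :> R by rewrite ler1n.
have s2R : 2 <= s0%:R :> R by rewrite ler_nat.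
have j1R : 1 <= j%:R :> R by rewrite ler1n.
have GE : #|G|%:R = m%:R + s0%:R * j%:R + s0%:R + 2 :> R by rewrite mE !natrD natrM.
have pER : p%:R = s0%:R * j%:R + 2 :> R by rewrite pE natrD natrM.
have [mu0 [mu0_ge mu0M row0]] := extremal_row_root c0 s2R (ler0n R p) m1R.
set lam0 := _ + c * s0%:R in row0.
have ext_eig : eigenvalue (deg_adj c (three_block s0 m p)) lam0.
  have mu1 : 0 < mu0 - 1 by lra.
  have mum : 0 < mu0 - m%:R by lra.
  apply: (three_block_eigenvalue (y := s0%:R / (1 + c) / (mu0 - m%:R))
                                 (z := s0%:R / (1 + c) / (mu0 - 1))).
  - exact: leq_trans s2.
  - by rewrite -row0; ring.
  - by rewrite /lam0; field; rewrite !gt_eqF.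
  - by rewrite /lam0; field; rewrite !gt_eqF.
have lam0_le := le_trans (eigenvalue_le_largest ext_eig) le_eig.
(* The left-hand side is the value of lam used below when S has more than s0
   vertices. *)
have lam0_ge : (1 + c) * (m%:R + s0%:R - 1) <= lam0.
  rewrite /lam0.
  have -> : (1 + c) * (m%:R + s0%:R - 1) = (1 + c) * (m%:R + s0%:R - c * s0%:R / (1 + c) - 1) + c * s0%:R.
    by field; rewrite gt_eqF.
  by rewrite lerD2r ler_pM2l // lerB.
have lam0_gt0 : 0 < lam0 by apply: lt_le_trans lam0_ge; rewrite mulr_gt0 //; lra.
case: (eqVneq #|S| s0) => [sE|sN].
  case: (pselect (exists2 a, eigenvalue (deg_adj c G) a & lam0 <= a)) => [[a Ga lam_a]|no].
    have XS1 : (p < #|X|)%N by rewrite pE -sE.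
    have ME : #|~: S|%:R - p%:R = m%:R :> R.
      by apply/eqP; rewrite subr_eq -natrD eqr_nat NE.
    have [|||_ univS [B [BS cB cliqueB]]] :=
      @comparison R G S X p SX XS1 c mu0 c0 S0 _ _ Gc a Ga _.
    - by rewrite ME.
    - rewrite ME sE -/lam0 -row0 GE pER; lra.
    - by rewrite sE -/lam0.
    apply: (@clique_with_pendants G j.+2 S (S :|: B)) => //.
    - by rewrite sE.
    - exact: finset.subsetUl.
    - move=> u v; rewrite !finset.in_setU => /orP[uS _ uv|uB]; first exact: univS.
      move=> /orP[vS uv|vB uv]; last exact: cliqueB.
      by rewrite adj_sym univS // eq_sym.
    by apply: restE => //; apply/eqP; rewrite finset.setIC setI_eq0.
  have lt : largest_eigenvalue (deg_adj c G) < lam0.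
    apply: largest_eigenvalue_lt => // a Ga; rewrite ltNge; apply/negP => lam_a.
    by apply: no; exists a.
  by move: lam0_le; rewrite leNgt lt.
have s_gt : (s0 < #|S|)%N by rewrite ltn_neqAle eq_sym sN.
exfalso.
pose s : R := #|S|%:R; pose d : R := s - s0%:R.
pose q := (#|S| * j + 2)%N.
have qER : q%:R = s * j%:R + 2 by rewrite /q natrD natrM.
pose M : R := #|~: S|%:R - q%:R.
have M1 : 1 <= M by rewrite /M lerBrDr nat1r ler_nat.
have d1 : 1 <= d by rewrite /d lerBrDr nat1r ler_nat.
have sE : s = s0%:R + d by rewrite /d addrC subrK.
pose Y : R := M + s + d * j%:R.
have GY : #|G|%:R = M + s * (j%:R + 1) + 2 :> R.
  by rewrite -nE natrD -/s /M qER; ring.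
have YE : Y = m%:R + s0%:R.
  have : #|G|%:R = Y + s0%:R * j%:R + 2 by rewrite GY /Y /d; ring.
  by rewrite GE; lra.
have := key d M d1 M1; rewrite /= -sE -/Y => key'.
have {}key' := key' ltac:(by rewrite GY /Y /d; ring).
pose mu := Y - c * s / (1 + c).
have lamE : (1 + c) * (mu - 1) + c * s = (1 + c) * (Y - 1).
  by rewrite /mu; field; rewrite gt_eqF.
have [muM row] : M < mu /\ c * (#|G|%:R - 1) + (s - 1)
  + s / (1 + c) * (q%:R / (mu - 1) + M / (mu - M)) < (1 + c) * (mu - 1) + c * s.
  have dj : 0 < d * j%:R by rewrite mulr_gt0; lra.
  case: cE => cE; move: key'; rewrite lamE /mu cE GY qER.
    rewrite !mul0r subr0 addr0 divr1 add0r mul1r => key'; split; first by rewrite /Y; lra.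
    by rewrite /Y sE; apply: row_strict0 => //; move: key'; rewrite /Y sE.
  have -> : 1 + 1 = 2 :> R by [].
  rewrite !mul1r => key'; split; first by have := sE; rewrite /Y; lra.
  have := @row_strict1 R j%:R s0%:R d M j1R s2R d1 M1; rewrite /= -sE -/Y => /(_ key').
  lra.
have lt : largest_eigenvalue (deg_adj c G) < lam0.
  apply: largest_eigenvalue_lt => // a Ga; rewrite ltNge; apply/negP => lam_a.
  have [|rowE _ _] := @comparison R G S X q SX qX c mu c0 S0 muM (ltW row) Gc a Ga _.
    by apply: le_trans lam_a; apply: le_trans lam0_ge; rewrite -/s lamE YE.
  by move: row; rewrite rowE ltxx.
by move: lam0_le; rewrite leNgt lt.
Qed.

Theorem theorem1p4 (R : realType) (k t : nat) (hk : (3 <= k)%N)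
  (ht : (1 <= t)%N) (s0 : nat)
  (hs0 : s0%:Z = Num.ceil ((3 * t%:R) / (t%:R + 1) : R))
  (G : sgraph) (n : nat) (hn : #|G| = n)
  (hconn : connected G)
  (htough : tough (t%:R / (t%:R * (k%:R - 1) + 1) : R) G) :
  (N1 s0%:R k%:R <= n%:R :> R ->
   rho R (extremal n k s0) <= rho R G ->
   has_spanning_ktree k G)
  /\
  (N2 s0%:R k%:R <= n%:R :> R ->
   q R (extremal n k s0) <= q R G ->
   has_spanning_ktree k G).
Proof.
have [tree|[S [X [_ SX cX]]]] := ktree_or_scattered (ltnW hk) hconn; first by [].
have s0S := tough_card_ge hk ht hs0 htough SX cX.
have s0E : (s0%:R = 2 :> R) \/ (s0%:R = 3 :> R).
  by case: (ceil_two_or_three ht hs0) => ->; [left | right].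
have s02 : (2 <= s0)%N by case: (ceil_two_or_three ht hs0) => ->.
pose j := (k - 2)%N; have kE : k = j.+2 by rewrite /j; lia.
have j1 : (1 <= j)%N by rewrite /j; lia.
have j1R : 1 <= j%:R :> R by rewrite ler1n.
have kR : k%:R = j%:R + 2 :> R by rewrite kE -addn2 natrD.
rewrite /N1 /N2 !ge_max kR !addrK -hn !rho_deg_adj !q_deg_adj kE.
split=> /andP[h1 h2] le_eig.
  apply: (@spectral_ktree R 0 j s0 G S X) => //; first by left.
  move=> d M d1 M1 s Y GY; rewrite mul0r subr0; apply: extra_vertices_ineq0 => //.
  by rewrite -GY.
apply: (@spectral_ktree R 1 j s0 G S X) => //; first by right.
move=> d M d1 M1 s Y GY; rewrite mul1r; apply: extra_vertices_ineq1 => //.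
by rewrite -GY.
Qed.
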